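(* Let $\mathbf f$ be a $k$-ary function symbol of $\mathcal M$, $k\in\{0,1,2\}$. Then there exist $c\in\omega$ and an existential first-order formula $\psi(x_0,\dots,x_{k-1},y,z,w)$ of $\mathcal M$ such that for all $d,t\in\omega$ with $d\ge t$, all $a_0,\dots,a_{k-1},b\in\mathbf M_d$, and all $v\in\omega$ with $v\ge t+c(d-t)$, we have $\mathbf f_{d,t}(a_0,\dots,a_{k-1})=b$ if and only if $\mathbf M_v\models\psi(a_0,\dots,a_{k-1},b,d,t)$.
   Context: $\mathcal M$ is the first-order language with equality with constant symbols $\mathbf 0,\mathbf 1,-\mathbf 1,\mathbf n$, unary function symbols $\mathcal N,\mathbf p$, and binary function symbols $+,\times,\div,\max,\min,\cap$. For $d\in\omega$ and $n=2^d$, $\mathbf M_d$ has universe $\{0,\dots,2^n-1\}$; $+,\times$ are modulo $2^n$; $\mathbf p(x)=\min\{2^x,2^n-1\}$; $\div(x,y)=\lfloor x/y\rfloor$ for $y\neq0$ and $0$ for $y=0$; constants denote $0,1,n,2^n-1$; $\max,\min$ usual; $\cap$ bitwise AND and $\mathcal N$ bitwise complement on $n$-bit binary representations. Note $\mathbf M_d\subseteq\mathbf M_v$ as sets of integers when $d\le v$. For $a,t\in\omega$, $a[i,t]$ is the $i$-th digit of $a$ in base $2^{2^t}$. For $d\ge t$, $\mathbf f_{d,t}(a_0,\dots,a_{k-1})$ is the unique $b\in\mathbf M_d$ with $\mathbf M_t\models\mathbf f(a_0[i,t],\dots,a_{k-1}[i,t])=b[i,t]$ for all $i<2^{d-t}$.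 *)

(* Defs.v *)
From HB Require Import structures.
From mathcomp Require Import all_boot.

Set Implicit Arguments.
Unset Strict Implicit.
Unset Printing Implicit Defensive.

(* Constant symbols are the function symbols of arity 0. *)
Inductive fsymb : Set :=
  | Zero | One | MinusOne | Nbits
  | Compl | Pow
  | Add | Mul | Div | Max | Min | Cap.

Definition arity (f : fsymb) : nat :=
  match f with
  | Zero | One | MinusOne | Nbits => 0
  | Compl | Pow => 1
  | Add | Mul | Div | Max | Min | Cap => 2
  end.

(* [term n] and [formula n] have their free variables among x_0, ..., x_(n-1).
   [Ex] and [All] bind the de Bruijn index 0 of their body. *)
Inductive term (n : nat) : Type :=
  | Var of 'I_n
  | App (f : fsymb) of ('I_(arity f) -> term n).

Inductive formula : nat -> Type :=
  | Eq n of term n & term n : formula n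
  | Not n of formula n : formula n
  | And n of formula n & formula n : formula n
  | Or n of formula n & formula n : formula n
  | Imp n of formula n & formula n : formula n
  | Ex n of formula n.+1 : formula n
  | All n of formula n.+1 : formula n.

Fixpoint quantifier_free n (phi : formula n) : bool :=
  match phi with
  | Eq _ _ _ => true
  | Not _ p => quantifier_free p
  | And _ p q | Or _ p q | Imp _ p q => quantifier_free p && quantifier_free q
  | Ex _ _ | All _ _ => false
  end.

(* A (possibly empty) block of existential quantifiers in front of a
   quantifier-free formula. *)
Fixpoint existential n (phi : formula n) : bool :=
  match phi with
  | Ex _ p => existential p
  | phi' => quantifier_free phi'
  end.

Record structure := Structure {
  carrier :> Type;
  interp : forall f : fsymb, ('I_(arity f) -> carrier) -> carrier }.

Definition env_cons (T : Type) n (x : T) (e : 'I_n -> T) : 'I_n.+1 -> T :=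
  fun i => if unlift ord0 i is Some j then e j else x.

Fixpoint eval (S : structure) n (e : 'I_n -> S) (u : term n) : S :=
  match u with
  | Var i => e i
  | App f us => interp (fun i => eval e (us i))
  end.

Fixpoint sat (S : structure) n (phi : formula n) : ('I_n -> S) -> Prop :=
  match phi in formula n return ('I_n -> S) -> Prop with
  | Eq _ u1 u2 => fun e => eval e u1 = eval e u2
  | Not _ p => fun e => ~ sat p e
  | And _ p q => fun e => sat p e /\ sat q e
  | Or _ p q => fun e => sat p e \/ sat q e
  | Imp _ p q => fun e => sat p e -> sat q e
  | Ex _ p => fun e => exists x : S, sat p (env_cons x e)
  | All _ p => fun e => forall x : S, sat p (env_cons x e)
  end.

Definition bit (x i : nat) : bool := odd (x %/ 2 ^ i).

(* In MathComp, [x %/ 0 = 0], as required of the division symbol. *)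
Definition opM (d : nat) (f : fsymb) : ('I_(arity f) -> nat) -> nat :=
  let n := 2 ^ d in
  match f return ('I_(arity f) -> nat) -> nat with
  | Zero => fun _ => 0
  | One => fun _ => 1
  | MinusOne => fun _ => 2 ^ n - 1
  | Nbits => fun _ => n
  | Compl => fun a => \sum_(i < n) (~~ bit (a ord0) i) * 2 ^ i
  | Pow => fun a => minn (2 ^ a ord0) (2 ^ n - 1)
  | Add => fun a => (a ord0 + a ord_max) %% 2 ^ n
  | Mul => fun a => (a ord0 * a ord_max) %% 2 ^ n
  | Div => fun a => a ord0 %/ a ord_max
  | Max => fun a => maxn (a ord0) (a ord_max)
  | Min => fun a => minn (a ord0) (a ord_max)
  | Cap => fun a => \sum_(i < n) (bit (a ord0) i && bit (a ord_max) i) * 2 ^ i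
  end.

Lemma sum_digits_lt B m (c : nat -> nat) :
  (forall i, c i < B) -> \sum_(i < m) c i * B ^ i < B ^ m.
Proof.
move=> cB; elim: m => [|m IH]; first by rewrite big_ord0.
rewrite big_ord_recr /= expnS.
apply: (@leq_trans (B ^ m + c m * B ^ m)); first by rewrite ltn_add2r.
by rewrite -mulSn leq_mul2r cB orbT.
Qed.

Lemma universe_gt0 d : 0 < 2 ^ (2 ^ d).
Proof. by rewrite expn_gt0. Qed.

Lemma opM_lt d (f : fsymb) (a : 'I_(arity f) -> nat) :
  (forall i, a i < 2 ^ (2 ^ d)) -> opM d a < 2 ^ (2 ^ d).
Proof.
have lt1 : 2 ^ (2 ^ d) - 1 < 2 ^ (2 ^ d) by rewrite subn1 prednK ?universe_gt0.
have bits (c : nat -> bool) : \sum_(i < 2 ^ d) c i * 2 ^ i < 2 ^ (2 ^ d).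
  by apply: (@sum_digits_lt 2 _ (fun i => c i : nat)) => i; case: (c i).
case: f a => /= a aM.
- exact: universe_gt0.
- by rewrite -{1}(expn0 2) ltn_exp2l // expn_gt0.
- exact: lt1.
- exact: ltn_expl.
- exact: (bits (fun i => ~~ bit _ i)).
- exact: leq_ltn_trans (geq_minr _ _) lt1.
- by rewrite ltn_pmod // universe_gt0.
- by rewrite ltn_pmod // universe_gt0.
- exact: leq_ltn_trans (leq_div _ _) (aM _).
- by rewrite gtn_max !aM.
- exact: leq_ltn_trans (geq_minl _ _) (aM _).
- exact: (bits (fun i => bit _ i && bit _ i)).
Qed.

Definition M (d : nat) : structure :=
  @Structure 'I_(2 ^ (2 ^ d))
    (fun f a => Ordinal (opM_lt (a := fun i => val (a i))
                                (fun i => ltn_ord (a i)))).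

(* [digit t a i] is a[i,t], as an element of the structure [M t]. *)
Definition digit (t a i : nat) : M t :=
  Ordinal (ltn_pmod (a %/ (2 ^ (2 ^ t)) ^ i) (universe_gt0 t)).

Definition digitwise (d t : nat) (f : fsymb) (a : 'I_(arity f) -> 'I_(2 ^ (2 ^ d)))
    (b : 'I_(2 ^ (2 ^ d))) : bool :=
  [forall i : 'I_(2 ^ (d - t)),
    (interp (fun j => digit t (a j) i) : 'I_(2 ^ (2 ^ t))) == digit t b i].

Lemma sum_digitE B m (c : nat -> nat) j : (forall i, c i < B) -> j < m ->
  (\sum_(i < m) c i * B ^ i) %/ B ^ j %% B = c j.
Proof.
move=> cB; have B0 : 0 < B by apply: leq_ltn_trans (cB 0).
elim: m c j cB => // m IH c j cB jm.
have E : \sum_(i < m.+1) c i * B ^ i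
         = (\sum_(i < m) c i.+1 * B ^ i) * B + c 0.
  rewrite big_ord_recl expn0 muln1 addnC; congr (_ + _).
  rewrite big_distrl /=; apply: eq_bigr => i _.
  by rewrite /bump /= add1n expnS mulnCA mulnC.
rewrite E; case: j jm => [|j] jm.
  by rewrite expn0 divn1 modnMDl modn_small.
by rewrite expnS divnMA divnMDl // (divn_small (cB 0)) addn0 (IH (c \o S)) // => i; apply: cB.
Qed.

Lemma digits_inj B m a b : 0 < B -> a < B ^ m -> b < B ^ m ->
  (forall i, i < m -> a %/ B ^ i %% B = b %/ B ^ i %% B) -> a = b.
Proof.
move=> B0; elim: m a b => [|m IH] a b.
  by rewrite expn0 !ltnS !leqn0 => /eqP-> /eqP->.
rewrite expnSr => am bm ab.
rewrite (divn_eq a B) (divn_eq b B); congr (_ * _ + _); last first.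
  by have := ab 0 isT; rewrite expn0 !divn1.
apply: IH; rewrite ?ltn_divLR // => i im.
by rewrite -!divnMA -expnS; apply: ab.
Qed.

Lemma universe_digits d t : t <= d -> 2 ^ (2 ^ d) = (2 ^ (2 ^ t)) ^ (2 ^ (d - t)).
Proof. by move=> td; rewrite -expnM -expnD subnKC. Qed.

Lemma digitwise_exists d t (f : fsymb) (a : 'I_(arity f) -> M d) :
  t <= d -> exists b, digitwise t a b.
Proof.
move=> td; pose c i : 'I__ := interp (fun j => digit t (a j : 'I__) i).
have cB i : c i < 2 ^ (2 ^ t) by apply: ltn_ord.
have bM := sum_digits_lt (2 ^ (d - t)) cB.
rewrite -universe_digits // in bM.
exists (Ordinal bM); apply/forallP => i; apply/eqP/val_inj => /=.
by rewrite (sum_digitE cB (ltn_ord i)).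
Qed.

Lemma digitwise_unique d t (f : fsymb) (a : 'I_(arity f) -> M d) (b b' : M d) :
  t <= d -> digitwise t a b -> digitwise t a b' -> b = b'.
Proof.
move=> td /forallP ab /forallP ab'; apply: val_inj.
apply: (@digits_inj (2 ^ (2 ^ t)) (2 ^ (d - t))); rewrite ?universe_gt0 //.
- by rewrite -universe_digits //; apply: ltn_ord.
- by rewrite -universe_digits //; apply: ltn_ord.
move=> i im; have /eqP := ab (Ordinal im); rewrite (eqP (ab' (Ordinal im))).
by move/(congr1 val).
Qed.

(* f_{d,t}: the unique [b] such that [digitwise t a b]. *)
Definition fdt (d t : nat) (td : t <= d) (f : fsymb) (a : 'I_(arity f) -> M d) :
  M d := xchoose (digitwise_exists a td).

Lemma fdtP d t (td : t <= d) (f : fsymb) (a : 'I_(arity f) -> M d) (b : M d) :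
  fdt td a = b <-> digitwise t a b.
Proof.
have P := xchooseP (digitwise_exists a td); rewrite /fdt.
by split=> [<- //|]; apply: digitwise_unique.
Qed.

Lemma universe_mono d v : d <= v -> 2 ^ (2 ^ d) <= 2 ^ (2 ^ v).
Proof. by move=> dv; rewrite !leq_pexp2l. Qed.

Lemma lt_universe d v : d <= v -> d < 2 ^ (2 ^ v).
Proof.
move=> dv; apply: leq_ltn_trans dv _.
by apply: ltn_trans (ltn_expl v _) (ltn_expl _ _).
Qed.

(* The inclusion of the universe of [M d] in that of [M v]. *)
Definition inclM (d v : nat) (dv : d <= v) (x : M d) : M v :=
  widen_ord (universe_mono dv) x.

(* The natural number [d] as an element of [M v]. *)
Definition natM (d v : nat) (dv : d <= v) : M v := Ordinal (lt_universe dv).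

Lemma bound_le c d t v :
  0 < c -> t <= d -> t + c * (d - t) <= v -> d <= v.
Proof.
move=> c0 td; apply: leq_trans.
by rewrite -{1}(subnKC td) leq_add2l leq_pmull.
Qed.

(* The assignment x_0, ..., x_(k-1), y, z, w := a_0, ..., a_(k-1), b, d, t of
   the k + 3 variables, in this order. *)
Definition params (T : Type) k (a : 'I_k -> T) (b d t : T) : 'I_(k + 3) -> T :=
  fun i => match split i with
           | inl j => a j
           | inr j => tnth [tuple b; d; t] j
           end.

(* Main.v *)
(* Write T = 2^t, K = 2^(d-t), B = 2^T.  A vector (x_i), i < K, of numbers of O(T)
   bits is coded by the sum of the x_i X^i, where X is a power of 2 with
   O(T K^2) bits.  Sums, multiples by a scalar and bitwise conjunctions of codes
   are computed digit by digit without carries.  Since X = Y modulo X - Y, the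
   remainder of a code modulo X - Y is the code of the same vector in the
   smaller base Y; in particular the given numbers are the remainders modulo
   X - B of their codes.  For products, code x in base Y and y in base Z = Y^K:
   a mask extracts the terms x_i y_i (YZ)^i from the product of the codes.
   Hence any existential system of such equations between digits is expressed
   by an existential formula in a structure with T K^10 bits, and there remains
   to describe each operation of M_t by such a system.  The only delicate one is
   x |-> 2^x.  With g about sqrt T and x = g x1 + x0, the power p = 2^(g x1) is
   a power of 2 under a mask, and x1 is the residue of (p - 1) / (2^g - 1)
   modulo 2^g - 1; for x0 use u = 2^((g+2) x0) in the same way, and 2^x0 is the
   residue of u modulo 2^(g+1) - 1.  When d = t there may be no extra room, and
   the operation is given by a term. *)
Require Import Defs.
From mathcomp Require Import all_boot zify.

Set Implicit Arguments.
Unset Strict Implicit.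
Unset Printing Implicit Defensive.

(** * Named syntax and its translation to de Bruijn formulas *)

(* Variables are de Bruijn levels: the context is listed from its outermost
   variable, so an index does not change under new quantifiers.  The two
   arguments of [TApp] are cut down to the arity of the symbol. *)
Inductive tm : Type :=
  | TVar of nat
  | TApp of fsymb & tm & tm.

Inductive fm : Type :=
  | FEq of tm & tm
  | FNot of fm
  | FAnd of fm & fm
  | FOr of fm & fm.

Definition args2 (T : Type) k (x y : T) : 'I_k -> T :=
  fun i => if val i == 0 then x else y.

Fixpoint tev (v : nat) (s : seq nat) (u : tm) : nat :=
  match u with
  | TVar k => nth 0 s k
  | TApp f u1 u2 => opM v (@args2 _ (arity f) (tev v s u1) (tev v s u2))
  end.

Fixpoint fholds (v : nat) (s : seq nat) (p : fm) : Prop :=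
  match p with
  | FEq u1 u2 => tev v s u1 = tev v s u2
  | FNot p => ~ fholds v s p
  | FAnd p q => fholds v s p /\ fholds v s q
  | FOr p q => fholds v s p \/ fholds v s q
  end.

Definition zero_term n : term n :=
  @App n Zero (fun i => False_rect _ (notF (ltn_ord i))).

(** In a context of length [n], level [k] is the index [n - k.+1]. A level outside the context
    becomes the constant zero, in agreement with the default value of [nth 0] in [tev]. *)
Fixpoint term_of n (u : tm) : term n :=
  match u with
  | TVar k => if k < n then (if insub (n - k.+1) is Some i then Var i else zero_term n)
              else zero_term n
  | TApp f u1 u2 => @App n f (@args2 _ (arity f) (term_of n u1) (term_of n u2))
  end.

Fixpoint formula_of n (p : fm) : formula n :=
  match p with
  | FEq u1 u2 => Eq (term_of n u1) (term_of n u2)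
  | FNot p => Not (formula_of n p)
  | FAnd p q => And (formula_of n p) (formula_of n q)
  | FOr p q => Or (formula_of n p) (formula_of n q)
  end.

Fixpoint exs m n : formula (m + n) -> formula n :=
  match m return formula (m + n) -> formula n with
  | 0 => id
  | m'.+1 => fun psi => exs (Ex psi)
  end.

(** The list starts with the outermost variable, whereas index 0 is the innermost one; hence the
    reversal. *)
Definition agree v n (e : 'I_n -> M v) (s : seq nat) :=
  size s = n /\ forall i : 'I_n, val (e i) = nth 0 (rev s) i.

Lemma opM_ext d (f : fsymb) (a a' : 'I_(arity f) -> nat) :
  a =1 a' -> opM d a = opM d a'.
Proof. by case: f a a' => /= a a' E; rewrite ?E. Qed.

Lemma eval_term_of v n (e : 'I_n -> M v) s u :
  agree e s -> val (eval e (term_of n u)) = tev v s u.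
Proof.
move=> [sz ag]; elim: u => [k|f u1 IH1 u2 IH2] /=.
  case: ifP => kn; last by rewrite nth_default // sz leqNgt kn.
  case: insubP => [i _ iE|]; last by rewrite -leqNgt; lia.
  rewrite /= ag nth_rev ?sz // iE; congr nth; lia.
by apply: opM_ext => i; rewrite /args2; case: ifP.
Qed.

Lemma sat_formula_of v n (e : 'I_n -> M v) s p :
  agree e s -> sat (formula_of n p) e <-> fholds v s p.
Proof.
move=> ag; elim: p => [u1 u2|p IH|p IHp q IHq|p IHp q IHq] /=.
- rewrite -!(eval_term_of _ ag); split=> [-> //|]; exact: val_inj.
- by rewrite IH.
- by rewrite IHp IHq.
- by rewrite IHp IHq.
Qed.

Lemma agree_cons v n (e : 'I_n -> M v) s (x : M v) :
  agree e s -> agree (env_cons x e) (rcons s (val x)).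
Proof.
move=> [sz ag]; split=> [|i]; first by rewrite size_rcons sz.
rewrite rev_rcons /env_cons; case: unliftP => [j|] ->; last by [].
by rewrite ag.
Qed.

(** [exs] adds its quantifiers from the inside, so the induction absorbs the innermost quantifier
    into the predicate [P]; its witness is the last entry of the list. *)
Lemma sat_exs v m n (psi : formula (m + n)) (P : seq nat -> Prop) :
  (forall e s, agree (v := v) e s -> sat psi e <-> P s) ->
  forall e s, agree (v := v) e s ->
  sat (exs psi) e <->
  exists xs, [/\ size xs = m, all (fun x => x < 2 ^ (2 ^ v)) xs & P (s ++ xs)].
Proof.
elim: m psi P => [|m IH] psi P psiP e s ag /=.
  rewrite (psiP _ _ ag); split=> [Ps|[xs [/size0nil -> _]]]; last by rewrite cats0.
  by exists [::]; rewrite cats0.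
pose P' s' := exists2 x, x < 2 ^ (2 ^ v) & P (rcons s' x).
rewrite (IH (Ex psi) P' _ _ _ ag); last first.
  move=> e' s' ag' /=; split=> [[x px]|[x xU px]].
    exists (val x); first exact: ltn_ord x.
    exact: (proj1 (psiP _ _ (agree_cons x ag')) px).
  by exists (Ordinal xU); exact: (proj2 (psiP _ _ (agree_cons (Ordinal xU : M v) ag')) px).
split=> [[xs [sz xsU [x xU Px]]]|[xs [sz]]].
  by exists (rcons xs x); rewrite size_rcons sz all_rcons xU xsU -rcons_cat.
case/lastP: xs sz => // xs x; rewrite size_rcons => -[sz].
rewrite all_rcons -rcons_cat => /andP[xU xsU] Px.
by exists xs; split => //; exists x.
Qed.

Lemma quantifier_free_formula_of n p : quantifier_free (formula_of n p).
Proof. by elim: p => //= p -> q ->. Qed.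

Lemma existential_exs m n (psi : formula (m + n)) :
  existential psi -> existential (exs psi).
Proof. by elim: m psi => //= m IH psi ex; apply: IH. Qed.

Lemma quantifier_free_existential n (psi : formula n) :
  quantifier_free psi -> existential psi.
Proof. by case: psi. Qed.

(** * Binary digits *)

(** Bitwise conjunction without reference to a universe: the bits of [a] from position [a] on
    vanish, since [a < 2 ^ a]. *)
Definition land (a b : nat) : nat := \sum_(i < a) (bit a i && bit b i) * 2 ^ i.

Lemma bit_small a i : a < 2 ^ i -> bit a i = false.
Proof. by move=> ai; rewrite /bit divn_small. Qed.

Lemma bit_sum (c : nat -> bool) n j :
  bit (\sum_(i < n) c i * 2 ^ i) j = (j < n) && c j.
Proof.
have c2 i : c i < 2 by case: (c i).
case: ltnP => jn /=.
  by rewrite /bit; have := sum_digitE c2 jn; rewrite modn2; case: odd (c j) => -[].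
by apply: bit_small; apply: leq_trans (sum_digits_lt n c2) _; rewrite leq_pexp2l.
Qed.

Lemma bit_inj a b : bit a =1 bit b -> a = b.
Proof.
move=> ab; apply: (@digits_inj 2 (a + b)) => //.
- by apply: leq_ltn_trans (leq_addr b a) (ltn_expl _ _).
- by apply: leq_ltn_trans (leq_addl a b) (ltn_expl _ _).
by move=> i _; rewrite !modn2; have := ab i; rewrite /bit => ->.
Qed.

Lemma sum_bit a n : a < 2 ^ n -> \sum_(i < n) bit a i * 2 ^ i = a.
Proof.
move=> an; apply: bit_inj => j; rewrite bit_sum; case: ltnP => //= nj.
by rewrite bit_small //; apply: leq_trans an _; rewrite leq_pexp2l.
Qed.

Lemma bit_land a b i : bit (land a b) i = bit a i && bit b i.
Proof.
rewrite (bit_sum (fun i => bit a i && bit b i)); case: ltnP => //= ai.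
by rewrite bit_small //; apply: leq_ltn_trans ai (ltn_expl _ _).
Qed.

Lemma landC a b : land a b = land b a.
Proof. by apply: bit_inj => i; rewrite !bit_land andbC. Qed.

Lemma land_leql a b : land a b <= a.
Proof.
rewrite -{2}(@sum_bit a a (ltn_expl _ _)) // /land.
by apply: leq_sum => i _; case: (bit a i); case: (bit b i); lia.
Qed.

Lemma land_leqr a b : land a b <= b.
Proof. by rewrite landC land_leql. Qed.

Lemma bit_addM x y n i : x < 2 ^ n ->
  bit (x + 2 ^ n * y) i = if i < n then bit x i else bit y (i - n).
Proof.
move=> xn; rewrite /bit; case: ltnP => ni.
  rewrite -(subnKC ni) addSnnS expnD -mulnA addnC mulnC divnMDl ?expn_gt0 //.
  by rewrite oddD expnS -mulnA oddM.
by rewrite -{1}(subnKC ni) expnD divnMA mulnC addnC divnMDl ?expn_gt0 // (divn_small xn) addn0.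
Qed.

Lemma land_addM x y x' y' n : x < 2 ^ n -> x' < 2 ^ n ->
  land (x + 2 ^ n * y) (x' + 2 ^ n * y') = land x x' + 2 ^ n * land y y'.
Proof.
move=> xn xn'; apply: bit_inj => i.
rewrite bit_land !bit_addM ?(leq_ltn_trans (land_leql _ _)) //.
by case: ifP; rewrite bit_land.
Qed.

Lemma bit_mask n i : bit (2 ^ n - 1) i = (i < n).
Proof.
have -> : 2 ^ n - 1 = \sum_(i < n) true * 2 ^ i.
  by rewrite subn1 predn_exp mul1n; apply: eq_bigr => j _; rewrite mul1n.
by rewrite (bit_sum (fun=> true)) andbT.
Qed.

Lemma land_mask x n : land x (2 ^ n - 1) = x %% 2 ^ n.
Proof.
apply: bit_inj => i; rewrite bit_land bit_mask {1}(divn_eq x (2 ^ n)) addnC mulnC.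
rewrite bit_addM ?ltn_pmod ?expn_gt0 //; case: ltnP => ni; rewrite ?andbT //= andbF.
rewrite bit_small //; apply: leq_trans (ltn_pmod _ _) _; rewrite ?expn_gt0 //.
by rewrite leq_pexp2l.
Qed.

Lemma land0n a : land 0 a = 0.
Proof. by rewrite /land big_ord0. Qed.

(** If [w.+1] lies strictly between two consecutive powers of 2, it shares its leading bit with
    [w]. *)
Lemma pow2_of_land w : land w.+1 w = 0 -> exists j, w.+1 = 2 ^ j.
Proof.
move=> w0; exists (trunc_log 2 w.+1).
have /andP[lo hi] := trunc_log_bounds (isT : 1 < 2) (isT : 0 < w.+1).
set j := trunc_log _ _ in lo hi *; move: lo; rewrite leq_eqVlt => /orP[/eqP //|lo].
have bitj x : 2 ^ j <= x -> x < 2 ^ j.+1 -> bit x j.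
  move=> jx xj; rewrite /bit; suff -> : x %/ 2 ^ j = 1 by [].
  apply/eqP; rewrite eqn_leq -ltnS ltn_divLR ?expn_gt0 // -expnS xj /=.
  by rewrite divn_gt0 ?expn_gt0.
have : bit (land w.+1 w) j by rewrite bit_land !bitj //; lia.
by rewrite w0 /bit div0n.
Qed.

Lemma bit_pow2 j i : bit (2 ^ j) i = (i == j).
Proof.
rewrite /bit; case: ltngtP => ij.
- by rewrite -(subnKC (ltnW ij)) expnD mulKn ?expn_gt0 // -(subnSK ij) expnS oddM.
- by rewrite divn_small // ltn_exp2l.
- by rewrite ij divnn expn_gt0.
Qed.

Lemma land_pow2 j : land (2 ^ j) (2 ^ j - 1) = 0.
Proof. by rewrite land_mask modnn. Qed.

Lemma land_pow2l j m : land (2 ^ j) m = bit m j * 2 ^ j.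
Proof.
apply: bit_inj => i; rewrite bit_land bit_pow2; case: eqVneq => [->|ij] /=.
  by case: (bit m j); rewrite ?mul1n ?mul0n ?bit_pow2 ?eqxx // /bit div0n.
by case: (bit m j); rewrite ?mul1n ?mul0n ?bit_pow2 ?(negbTE ij) // /bit div0n.
Qed.

Lemma opM_cap v a b : a < 2 ^ (2 ^ v) ->
  \sum_(i < 2 ^ v) (bit a i && bit b i) * 2 ^ i = land a b.
Proof.
move=> aU; apply: bit_inj => i; rewrite (bit_sum (fun i => bit a i && bit b i)).
rewrite bit_land; case: ltnP => //= vi; rewrite bit_small //.
by apply: leq_trans aU _; rewrite leq_pexp2l.
Qed.

Lemma opM_compl v a : a < 2 ^ (2 ^ v) ->
  \sum_(i < 2 ^ v) (~~ bit a i) * 2 ^ i + a = 2 ^ (2 ^ v) - 1.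
Proof.
move=> aU; rewrite -{2}(sum_bit aU) -big_split /= subn1 predn_exp mul1n.
by apply: eq_bigr => i _; case: bit; rewrite ?mul1n ?mul0n ?addn0.
Qed.

(** * Vectors of digits *)

Definition enc (X K : nat) (x : nat -> nat) : nat := \sum_(i < K) x i * X ^ i.

Lemma encS X K x : enc X K.+1 x = x 0 + X * enc X K (fun i => x i.+1).
Proof.
rewrite /enc big_ord_recl expn0 muln1; congr (_ + _).
by rewrite big_distrr; apply: eq_bigr => i _ /=; rewrite /bump add1n expnS mulnCA.
Qed.

Lemma eq_enc X K x y : (forall i, i < K -> x i = y i) -> enc X K x = enc X K y.
Proof. by move=> xy; apply: eq_bigr => i _; rewrite xy. Qed.

Lemma encD X K x y : enc X K x + enc X K y = enc X K (fun i => x i + y i).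
Proof. by rewrite /enc -big_split; apply: eq_bigr => i _; rewrite mulnDl. Qed.

Lemma encM X K c x : c * enc X K x = enc X K (fun i => c * x i).
Proof. by rewrite /enc big_distrr; apply: eq_bigr => i _; rewrite /= mulnA. Qed.

Lemma enc_lt X K x : (forall i, i < K -> x i < X) -> enc X K x < X ^ K.
Proof.
move=> xX; case: K xX => [|K] xX; first by rewrite /enc big_ord0.
have X0 : 0 < X by apply: leq_ltn_trans (xX 0 isT).
pose y i := if i < K.+1 then x i else 0.
rewrite (@eq_enc _ _ _ y) => [|i iK]; last by rewrite /y iK.
by apply: sum_digits_lt => i; rewrite /y; case: ifP => // /xX.
Qed.

Lemma enc_inj X K x y : (forall i, i < K -> x i < X) -> (forall i, i < K -> y i < X) ->
  enc X K x = enc X K y -> forall i, i < K -> x i = y i.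
Proof.
elim: K x y => // K IH x y xX yX; rewrite !encS => E.
have X0 : 0 < X by apply: leq_ltn_trans (xX 0 isT).
have E0 : x 0 = y 0.
  by move/(congr1 (modn^~ X)): E; rewrite !(addnC _ (X * _)) !(mulnC X) !modnMDl !modn_small ?xX ?yX.
move: E; rewrite E0 => /addnI/eqP; rewrite eqn_pmul2l // => /eqP E.
by case=> [//|i] iK; apply: IH E i iK => j jK; [apply: xX | apply: yX].
Qed.

Lemma enc_digits X K a : a < X ^ K -> a = enc X K (fun i => a %/ X ^ i %% X).
Proof.
elim: K a => [|K IH] a aK; first by rewrite /enc big_ord0; move: aK; rewrite expn0; case: a.
have X0 : 0 < X by case: posnP aK => // ->; rewrite exp0n.
have aK' : a %/ X < X ^ K by rewrite ltn_divLR // -expnSr.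
rewrite encS expn0 divn1 {1}(divn_eq a X) addnC mulnC {1}(IH _ aK'); congr (_ + _ * _).
by apply: eq_enc => i _; rewrite -divnMA -expnS.
Qed.

Lemma enc_land n K x y : (forall i, i < K -> x i < 2 ^ n) -> (forall i, i < K -> y i < 2 ^ n) ->
  land (enc (2 ^ n) K x) (enc (2 ^ n) K y) = enc (2 ^ n) K (fun i => land (x i) (y i)).
Proof.
elim: K x y => [|K IH] x y xX yX; first by rewrite /enc !big_ord0 land0n.
rewrite !encS land_addM ?xX ?yX // IH // => i iK; [exact: xX | exact: yX].
Qed.

Lemma bit_enc n K x i r : (forall i, i < K -> x i < 2 ^ n) -> r < n -> i < K ->
  bit (enc (2 ^ n) K x) (n * i + r) = bit (x i) r.
Proof.
elim: K x i => // K IH x i xX rn iK; rewrite encS bit_addM ?xX //.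
case: i iK => [|i] iK; first by rewrite muln0 add0n rn.
rewrite ifN; last by rewrite -leqNgt mulnS -addnA leq_addr.
rewrite mulnS -addnA addKn IH // => j jK; exact: xX.
Qed.

(* [Y = X] modulo [X - Y] turns base [X] into base [Y]. *)
Lemma enc_base X Y K x : Y <= X -> exists r, enc X K x = enc Y K x + (X - Y) * r.
Proof.
move=> YX; elim: K x => [|K IH] x; first by exists 0; rewrite /enc !big_ord0 muln0.
have [r rE] := IH (fun i => x i.+1).
exists (enc Y K (fun i => x i.+1) + X * r); rewrite !encS rE.
rewrite -{1}(subnK YX); nia.
Qed.

(** The hypothesis puts the code in base [Y] below the modulus. *)
Lemma enc_mod X Y K x : enc Y K x + Y < X -> enc X K x %% (X - Y) = enc Y K x.
Proof.
move=> lt; have [|r ->] := @enc_base X Y K x; first lia.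
by rewrite addnC mulnC modnMDl modn_small //; lia.
Qed.

Lemma enc_cst X K c : enc X K (fun=> c) = c * enc X K (fun=> 1).
Proof. by rewrite encM; apply: eq_enc => i _; rewrite muln1. Qed.

Lemma enc1E X K : (X - 1) * enc X K (fun=> 1) = X ^ K - 1.
Proof. by rewrite !subn1 predn_exp; congr (_ * _); apply: eq_bigr => i _; rewrite mul1n. Qed.

Lemma enc1_div X K : 1 < X -> (X ^ K - 1) %/ (X - 1) = enc X K (fun=> 1).
Proof. by move=> X1; rewrite -enc1E mulKn // subn_gt0. Qed.

Definition dig (X N i : nat) : nat := N %/ X ^ i %% X.

Lemma dig_lt X N i : 0 < X -> dig X N i < X.
Proof. exact: ltn_pmod. Qed.

(** A number under the mask is below the [K]-th power of the base, hence is the code of its own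
    digits. This is how a quantified number is forced to be a code. *)
Lemma enc_submask n K N c : c < 2 ^ n -> land N (enc (2 ^ n) K (fun=> c)) = N ->
  N = enc (2 ^ n) K (dig (2 ^ n) N) /\
  forall i, i < K -> land (dig (2 ^ n) N i) c = dig (2 ^ n) N i.
Proof.
move=> cn NE; have NK : N < (2 ^ n) ^ K.
  by rewrite -NE; apply: leq_ltn_trans (land_leqr _ _) (enc_lt _).
have lt i : dig (2 ^ n) N i < 2 ^ n by rewrite dig_lt ?expn_gt0.
have NdE : N = enc (2 ^ n) K (dig (2 ^ n) N) by apply: enc_digits.
split=> // i iK; move: NE; rewrite {1 2}NdE enc_land // => E.
apply: (enc_inj _ _ E iK) => j jK; last exact: lt.
exact: leq_ltn_trans (land_leql _ _) (lt j).
Qed.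

(* Products [x_i y_j] occupy the positions [Y^i Z^j]; the mask keeps [i = j]. *)
Lemma enc_diag n K x y : (forall i j, i < K -> j < K -> x i * y j < 2 ^ n) ->
  let Z := 2 ^ (n * K) in
  land (enc (2 ^ n) K x * enc Z K y) ((2 ^ n - 1) * enc (2 ^ n * Z) K (fun=> 1))
  = enc (2 ^ n * Z) K (fun i => x i * y i).
Proof.
move=> xy Z; have n0 : 0 < 2 ^ n by rewrite expn_gt0.
have n1 : 2 ^ n - 1 < 2 ^ n by lia.
pose delta (j c i : nat) := if i == j then c else 0.
have encdelta j c : j < K -> enc (2 ^ n) K (delta j c) = c * (2 ^ n) ^ j.
  move=> jK; rewrite /enc (bigD1 (Ordinal jK)) //= /delta eqxx big1 ?addn0 // => i ij.
  by rewrite ifN.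
(* Everything is regrouped in base [Z], with digits that are themselves codes in base [2 ^ n]; those
   of the mask are codes of the vectors [delta j (2 ^ n - 1)]. *)
have mixE z : enc (2 ^ n * Z) K z = enc Z K (fun i => z i * (2 ^ n) ^ i).
  by apply: eq_bigr => i _; rewrite expnMn mulnA.
rewrite mixE encM !mixE encM.
rewrite (@eq_enc _ _ (fun j => enc (2 ^ n) K x * y j)
                     (fun j => enc (2 ^ n) K (fun i => x i * y j))); last first.
  by move=> j jK; rewrite mulnC encM; apply: eq_enc => i _; rewrite mulnC.
rewrite (@eq_enc _ _ (fun j => (2 ^ n - 1) * (1 * (2 ^ n) ^ j))
                     (fun j => enc (2 ^ n) K (delta j (2 ^ n - 1)))); last first.
  by move=> j jK; rewrite mul1n encdelta.
rewrite enc_land; last 2 first.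
- by move=> j jK; rewrite expnM; apply: enc_lt => i iK; apply: xy.
- by move=> j jK; rewrite expnM; apply: enc_lt => i iK; rewrite /delta; case: ifP.
apply: eq_enc => j jK; rewrite -encdelta // enc_land.
- apply: eq_enc => i iK; rewrite /delta; case: eqP => [->|_]; last by rewrite landC land0n.
  by rewrite land_mask modn_small // xy.
- by move=> i iK; apply: xy.
- by move=> i iK; rewrite /delta; case: ifP.
Qed.

(** * Arithmetic terms *)

Definition tzero := TApp Zero (TVar 0) (TVar 0).
Definition tone := TApp One (TVar 0) (TVar 0).
Definition tmone := TApp MinusOne (TVar 0) (TVar 0).
Definition tpow u := TApp Pow u u.
Definition tadd := TApp Add.
Definition tmul := TApp Mul.
Definition tdiv := TApp Div.
Definition tcap := TApp Cap.
(** Adding or multiplying by the constant [MinusOne] acts as by -1 modulo the size of the universe,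
    which gives subtraction. *)
Definition tpred u := tadd u tmone.
Definition tsub u w := tadd u (tmul tmone w).
Definition tmod u w := tsub u (tmul (tdiv u w) w).
Definition tnum n := iter n (tadd tone) tzero.

(** * Values of terms in the absence of overflow *)

Section Evaluation.

Variables (v : nat) (s : seq nat).
Hypothesis sU : all (fun x => x < 2 ^ (2 ^ v)) s.

Local Notation U := (2 ^ (2 ^ v)).
Local Notation ev := (tev v s).

Lemma tev_lt u : ev u < U.
Proof.
elim: u => [k|f u1 IH1 u2 IH2] /=.
  case: (ltnP k (size s)) => ks; last by rewrite nth_default // universe_gt0.
  exact: (all_nthP 0 sU).
by apply: opM_lt => i; rewrite /args2; case: ifP.
Qed.

Lemma tev_pow u : ev u < 2 ^ v -> ev (tpow u) = 2 ^ ev u.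
Proof.
move=> uv; rewrite /= /args2 /=; apply/minn_idPl.
have : 2 ^ ev u < U by rewrite ltn_exp2l.
lia.
Qed.

Lemma tev_add u w : ev u + ev w < U -> ev (tadd u w) = ev u + ev w.
Proof. exact: modn_small. Qed.

Lemma tev_mul u w : ev u * ev w < U -> ev (tmul u w) = ev u * ev w.
Proof. exact: modn_small. Qed.

Lemma tev_div u w : ev (tdiv u w) = ev u %/ ev w.
Proof. by []. Qed.

Lemma tev_cap u w : ev (tcap u w) = land (ev u) (ev w).
Proof. exact: opM_cap (tev_lt u). Qed.

Lemma tev_sub u w : ev w <= ev u -> ev (tsub u w) = ev u - ev w.
Proof.
move=> wu; have uU := tev_lt u; rewrite /= /args2 /= modnDmr.
have -> : ev u + (U - 1) * ev w = ev w * U + (ev u - ev w) by nia.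
by rewrite modnMDl modn_small //; lia.
Qed.

Lemma tev_pred u : 0 < ev u -> ev (tpred u) = ev u - 1.
Proof.
move=> u0; have uU := tev_lt u; rewrite /= /args2 /=.
have -> : ev u + (U - 1) = 1 * U + (ev u - 1) by lia.
by rewrite modnMDl modn_small //; lia.
Qed.

Lemma tev_mod u w : ev (tmod u w) = ev u %% ev w.
Proof.
have le : ev (tdiv u w) * ev w <= ev u by rewrite tev_div leq_divM.
have eqm : ev (tmul (tdiv u w) w) = ev u %/ ev w * ev w.
  by apply: tev_mul; apply: leq_ltn_trans le (tev_lt u).
by rewrite tev_sub eqm // {1}(divn_eq (ev u) (ev w)) addKn.
Qed.

Lemma tev_num n : n < U -> ev (tnum n) = n.
Proof.
elim: n => // n IH nU; rewrite -[RHS]add1n -{2}IH; last lia.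
by apply: tev_add; rewrite IH; [|lia]; exact: nU.
Qed.

Lemma ltn_universe n : n <= 2 ^ v -> n < U.
Proof. by move=> nv; apply: leq_ltn_trans nv (ltn_expl _ _). Qed.

End Evaluation.

(** * Digit constraints *)

(** [CB] is the base of the given digits. [CG1], [CH1], [CL1] are the moduli and [CMg], [CMh] the
    masks used for [x |-> 2 ^ x]. *)
Inductive cst := C0 | C1 | CT | CB | CB1 | Cg | CG1 | CH1 | CL1 | CMg | CMh.

(* [g^2] is [2^t] or [2^(t+1)]. *)
Definition hroot t := 2 ^ (t.+1 %/ 2).

Definition cval t (c : cst) : nat :=
  let g := hroot t in
  match c with
  | C0 => 0
  | C1 => 1
  | CT => 2 ^ t
  | CB => 2 ^ (2 ^ t)
  | CB1 => 2 ^ (2 ^ t) - 1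
  | Cg => g
  | CG1 => 2 ^ g - 1
  | CH1 => 2 ^ g.+2 - 1
  | CL1 => 2 ^ g.+1 - 1
  | CMg => enc (2 ^ g) g (fun=> 1)
  | CMh => enc (2 ^ g.+2) g (fun=> 1)
  end.

(** These operations commute with coding as long as no digit overflows. The product of two vectors
    does not, and has its own constraint [CMul] between variables. *)
Inductive vexp :=
  | XVar of nat
  | XCst of cst
  | XAdd of vexp & vexp
  | XScal of cst & vexp
  | XLand of vexp & vexp.

Inductive cn :=
  | CEq of vexp & vexp
  | CMul of nat & nat & nat.

Fixpoint dex t (y : nat -> nat) (e : vexp) : nat :=
  match e with
  | XVar j => y j
  | XCst c => cval t c
  | XAdd e1 e2 => dex t y e1 + dex t y e2
  | XScal c e1 => cval t c * dex t y e1
  | XLand e1 e2 => land (dex t y e1) (dex t y e2)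
  end.

Definition dcn t y (c : cn) : Prop :=
  match c with
  | CEq e1 e2 => dex t y e1 = dex t y e2
  | CMul j1 j2 j3 => y j1 * y j2 = y j3
  end.

Definition dcns t y (cs : seq cn) : Prop := foldr (fun c P => dcn t y c /\ P) True cs.

(** The length of a value in units of [2 ^ (t + 3)] bits. The bound 8 in [wf] allows [2 ^ (t + 6)]
    bits, which fit in one digit of the base [2 ^ E] of the codes. *)
Fixpoint weight (e : vexp) : nat :=
  match e with
  | XVar _ | XCst _ => 1
  | XAdd e1 e2 => (maxn (weight e1) (weight e2)).+1
  | XScal _ e1 => (weight e1).+1
  | XLand e1 e2 => maxn (weight e1) (weight e2)
  end.

Definition wf (c : cn) : bool :=
  if c is CEq e1 e2 then (weight e1 <= 8) && (weight e2 <= 8) else true.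

Lemma hroot_bounds t : 2 ^ t <= hroot t * hroot t <= 2 * 2 ^ t.
Proof.
rewrite -expnD -expnS !leq_pexp2l //; lia.
Qed.

Lemma hroot_gt0 t : 0 < hroot t.
Proof. by rewrite expn_gt0. Qed.

Lemma enc1_lt n K k : 0 < n -> n * K <= k -> enc (2 ^ n) K (fun=> 1) < 2 ^ k.
Proof.
move=> n0 nK; apply: (@leq_trans ((2 ^ n) ^ K)).
  by apply: enc_lt => i _; rewrite -{1}(expn0 2) ltn_exp2l.
by rewrite -expnM leq_pexp2l.
Qed.

(** The mask [CMh] takes at most [g * g.+2 <= 6 * 2 ^ t] bits, within the [8 * 2 ^ t] bits allowed
    for a digit. *)
Lemma cval_lt t c : cval t c < 2 ^ (2 ^ (t + 3)).
Proof.
have /andP[lo hi] := hroot_bounds t; have g0 := hroot_gt0 t.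
have T0 : 0 < 2 ^ t by rewrite expn_gt0.
have e8 : 2 ^ (t + 3) = 8 * 2 ^ t by rewrite expnD mulnC.
have gT : hroot t <= 2 * 2 ^ t by nia.
have p1 k : k <= 8 * 2 ^ t -> 2 ^ k - 1 < 2 ^ (2 ^ (t + 3)).
  move=> kT; have : 2 ^ k <= 2 ^ (2 ^ (t + 3)) by rewrite leq_pexp2l ?e8.
  have : 0 < 2 ^ k by rewrite expn_gt0.
  lia.
have p2 k : k <= 8 * 2 ^ t -> k < 2 ^ (2 ^ (t + 3)).
  by move=> kT; apply: leq_ltn_trans kT _; rewrite -e8 ltn_expl.
case: c => /=; rewrite ?expn_gt0 //.
- by apply: p2; lia.
- by apply: p2; lia.
- by rewrite ltn_exp2l ?e8 //; lia.
- by apply: p1; lia.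
- by apply: p2; lia.
- by apply: p1; lia.
- by apply: p1; lia.
- by apply: p1; lia.
- by apply: enc1_lt => //; rewrite e8; lia.
- by apply: enc1_lt => //; rewrite e8; nia.
Qed.

Lemma dex_lt t y e : (forall j, y j < 2 ^ (2 ^ (t + 3))) ->
  dex t y e < 2 ^ (2 ^ (t + 3) * weight e).
Proof.
move=> yb; have S0 : 0 < 2 ^ (t + 3) by rewrite expn_gt0.
elim: e => [j|c|e1 IH1 e2 IH2|c e IH|e1 IH1 e2 IH2] /=.
- by rewrite muln1.
- by rewrite muln1 cval_lt.
- set k := maxn _ _; apply: (@leq_trans (2 ^ (2 ^ (t + 3) * k).+1)).
    rewrite expnS mul2n -addnn -addnS leq_add // ?(leq_trans (ltnW IH1)) ?(leq_trans IH2) //.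
      by rewrite leq_pexp2l // leq_mul2l leq_maxl orbT.
    by rewrite leq_pexp2l // leq_mul2l leq_maxr orbT.
  by rewrite leq_pexp2l // mulnS; lia.
- by rewrite mulnS expnD ltn_mul ?cval_lt.
- apply: leq_ltn_trans (land_leql _ _) _; apply: leq_trans IH1 _.
  by rewrite leq_pexp2l // leq_mul2l leq_maxl orbT.
Qed.

Lemma eq_dcns t y y' cs : y =1 y' -> dcns t y cs -> dcns t y' cs.
Proof.
move=> yy'; have dexE e : dex t y e = dex t y' e.
  by elim: e => //= [e1 -> e2 ->|c e ->|e1 -> e2 ->].
elim: cs => //= c cs IH [Hc Hcs]; split; last exact: IH.
by move: Hc {IH Hcs}; case: c => [e1 e2|j1 j2 j3] /=; rewrite ?dexE ?yy'.
Qed.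

(** * The formula expressing digit constraints *)

(* The environment starts with [t; d]. *)
Definition tshift a := tpow (tadd (TVar 0) (tnum a)).
Definition tK := tdiv (tpow (TVar 1)) (tpow (TVar 0)).
(** A geometric sum: the code in base [2 ^ u] of the vector of [k] ones. *)
Definition tgeo u k := tdiv (tpred (tpow (tmul u k))) (tpred (tpow u)).
Definition troot := tpow (tdiv (tadd (TVar 0) tone) (tnum 2)).

Definition tcst (c : cst) : tm :=
  match c with
  | C0 => tzero
  | C1 => tone
  | CT => tshift 0
  | CB => tpow (tshift 0)
  | CB1 => tpred (tpow (tshift 0))
  | Cg => troot
  | CG1 => tpred (tpow troot)
  | CH1 => tpred (tpow (tadd troot (tnum 2)))
  | CL1 => tpred (tpow (tadd troot tone))
  | CMg => tgeo troot troot
  | CMh => tgeo (tadd troot (tnum 2)) troot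
  end.

(* Vectors are coded in base [X = 2^E]; [Y = 2^e] and [Z = Y^K] serve for products. *)
Definition tE := tmul (tmul (tshift 6) tK) tK.
Definition tX := tpow tE.
Definition tones := tgeo tE tK.
Definition te := tshift 4.
Definition teK := tmul te tK.
Definition teK1 := tadd te teK.
Definition trebase u l := tmod u (tsub tX (tpow l)).
Definition tdiag := tmul (tpred (tpow te)) (tgeo teK1 tK).

Fixpoint tex off (e : vexp) : tm :=
  match e with
  | XVar j => TVar (off + j)
  | XCst c => tmul (tcst c) tones
  | XAdd e1 e2 => tadd (tex off e1) (tex off e2)
  | XScal c e1 => tmul (tcst c) (tex off e1)
  | XLand e1 e2 => tcap (tex off e1) (tex off e2)
  end.

Definition fcn off (c : cn) : fm :=
  match c with
  | CEq e1 e2 => FEq (tex off e1) (tex off e2)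
  | CMul j1 j2 j3 =>
      FEq (tcap (tmul (trebase (TVar (off + j1)) te) (trebase (TVar (off + j2)) teK)) tdiag)
          (trebase (TVar (off + j3)) teK1)
  end.

Definition fands (ps : seq fm) : fm := foldr FAnd (FEq tzero tzero) ps.

(** When [u + 1] is a power of 2, this bounds every digit of the coded vector by [u]. *)
Definition finside k off u : fm :=
  FEq (tcap (TVar (off + k)) (tmul u tones)) (TVar (off + k)).

(** The positions below [k.+3] hold [t], [d], the value and the [k] arguments; the [m] quantified
    numbers follow. The first conjunct makes these codes of short digits, the second makes the first
    [k.+1] of them recodings of the value and the arguments, and the third imposes the
    constraints. *)
Definition fmain k m (cs : seq cn) : fm :=
  let off := k.+3 in
  FAnd (fands [seq finside j off (tpred (tpow (tshift 3))) | j <- iota 0 m])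
  (FAnd (fands [seq FAnd (finside j off (tcst CB1))
                         (FEq (trebase (TVar (off + j)) (tshift 0)) (TVar (2 + j)))
               | j <- iota 0 k.+1])
        (fands [seq fcn off c | c <- cs])).

Lemma fholds_eq v s u w : fholds v s (FEq u w) = (tev v s u = tev v s w).
Proof. by []. Qed.

Lemma fholds_and v s p q : fholds v s (FAnd p q) = (fholds v s p /\ fholds v s q).
Proof. by []. Qed.

Lemma fholds_fands_iota v s (F : nat -> fm) n :
  fholds v s (fands [seq F j | j <- iota 0 n]) <-> forall j, j < n -> fholds v s (F j).
Proof.
have -> : (forall j, j < n -> fholds v s (F j)) <->
          (forall j, j \in iota 0 n -> fholds v s (F j)).
  by split=> H j jn; apply: H; move: jn; rewrite mem_iota add0n.
elim: (iota 0 n) => [|i r IH] /=; first by split.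
rewrite IH; split=> [[Fi Fr] j|H]; last first.
  by split=> [|j jr]; apply: H; rewrite inE ?eqxx ?jr ?orbT.
by rewrite inE => /orP[/eqP->|/Fr].
Qed.

(** * Values of the terms when [t < d] and the universe is large enough *)

Section Room.

Variables v d t : nat.
Hypotheses (td : t < d) (hv : t + 10 * (d - t) <= v).

Local Notation U := (2 ^ (2 ^ v)).
Local Notation V := (2 ^ v).
Local Notation K := (2 ^ (d - t)).
Local Notation T := (2 ^ t).
Local Notation S := (2 ^ (t + 3)).
Local Notation e := (2 ^ (t + 4)).
Local Notation E := (2 ^ (t + 6) * K * K).

Lemma K_ge2 : 2 <= K.
Proof. by rewrite -{1}(expn1 2) leq_pexp2l // subn_gt0. Qed.

(** A code has [E * K = 2 ^ (t + 6 + 3 * (d - t))] bits, and [6 + 3 * (d - t) < 10 * (d - t)] since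
    [t < d]; the constant 10 is chosen for this. *)
Lemma room : E * K < V.
Proof.
apply: leq_trans (_ : 2 ^ (t + 10 * (d - t)) <= _); last by rewrite leq_pexp2l.
by rewrite -!expnD ltn_exp2l //; lia.
Qed.

Lemma shiftE a : 2 ^ (t + a) = 2 ^ a * T.
Proof. by rewrite expnD mulnC. Qed.

Lemma room8 : 512 * T < V.
Proof.
apply: leq_trans (_ : 2 ^ (t + 10 * (d - t)) <= _); last by rewrite leq_pexp2l.
by rewrite (_ : 512 = 2 ^ 9) // -!expnD ltn_exp2l //; lia.
Qed.

Lemma T_gt0 : 0 < T. Proof. by rewrite expn_gt0. Qed.

Lemma t_lt_T : t < T. Proof. exact: ltn_expl. Qed.

(** A chain of monomials, each at least doubled by the next because [K >= 2]; the later comparisons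
    of lengths follow from it. *)
Lemma monomials : [/\ 0 < T, 2 * T <= T * K, 2 * (T * K) <= T * K * K,
  2 * (T * K * K) <= T * K * K * K & 64 * (T * K * K * K) < V].
Proof.
have := room; rewrite shiftE (_ : 2 ^ 6 = 64) // => rm.
split; rewrite ?(mulnC 2) ?leq_mul2l ?K_ge2 ?orbT ?T_gt0 //; lia.
Qed.

Ltac room_lia :=
  have [] := monomials; rewrite ?shiftE ?[2 ^ 6]/(64) ?[2 ^ 4]/(16) ?[2 ^ 3]/(8);
  move: (2 ^ t) (2 ^ (d - t)) (2 ^ v) => T' K' V' ? ? ? ? ?; nia.

Variable r : seq nat.
Hypothesis sU : all (fun x => x < 2 ^ (2 ^ v)) [:: t, d & r].
Local Notation ev := (tev v [:: t, d & r]).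

Lemma evpow u x : ev u = x -> x < V -> ev (tpow u) = 2 ^ x.
Proof. by move=> <-; apply: (tev_pow sU). Qed.

Lemma evadd u w x y : ev u = x -> ev w = y -> x + y <= V -> ev (tadd u w) = x + y.
Proof. by move=> <- <- ?; apply: tev_add; apply: ltn_universe. Qed.

Lemma evmul u w x y : ev u = x -> ev w = y -> x * y <= V -> ev (tmul u w) = x * y.
Proof. by move=> <- <- ?; apply: tev_mul; apply: ltn_universe. Qed.

Lemma evpred u x : ev u = x -> 0 < x -> ev (tpred u) = x - 1.
Proof. by move=> <-; apply: (tev_pred sU). Qed.

Lemma evnum n : n <= V -> ev (tnum n) = n.
Proof. by move=> nV; apply: (tev_num sU); apply: ltn_universe. Qed.

Lemma evgeo u w x y : ev u = x -> ev w = y -> 0 < x -> 0 < y -> x * y < V ->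
  ev (tgeo u w) = enc (2 ^ x) y (fun=> 1).
Proof.
move=> ux wy x0 y0 xy; rewrite tev_div.
rewrite (@evpred _ (2 ^ (x * y))) ?expn_gt0 //; last first.
  by apply: evpow => //; apply: evmul => //; apply: ltnW.
rewrite (@evpred _ (2 ^ x)) ?expn_gt0 //; last by apply: evpow => //; nia.
by rewrite expnM enc1_div // -{1}(expn0 2) ltn_exp2l.
Qed.

Lemma evshift a : a <= 6 -> ev (tshift a) = 2 ^ (t + a).
Proof.
move=> a6; have := room8; have := t_lt_T => ? ?.
by apply: evpow; [apply: evadd => //; [apply: evnum|]|]; lia.
Qed.

Lemma evmask : ev (tpred (tpow (tshift 3))) = 2 ^ S - 1.
Proof.
apply: evpred; rewrite ?expn_gt0 //; apply: evpow; first exact: evshift.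
room_lia.
Qed.

Lemma evK : ev tK = K.
Proof.
have := room8; have := t_lt_T => tT ?.
have dV : d < V by apply: leq_ltn_trans (ltn_expl v _) => //; lia.
rewrite tev_div (@evpow _ d) // (@evpow _ t) //; last lia.
by rewrite expnB // ltnW.
Qed.

Lemma evroot : ev troot = hroot t.
Proof.
have := room8; have := t_lt_T => tT ?.
have ea : ev (tadd (TVar 0) tone) = t + 1 by apply: evadd => //; lia.
have en : ev (tnum 2) = 2 by apply: evnum; lia.
by apply: evpow; rewrite ?tev_div ?ea ?en ?addn1 //; lia.
Qed.

Lemma evcst c : ev (tcst c) = cval t c.
Proof.
have /andP[lo hi] := hroot_bounds t; have g0 := hroot_gt0 t.
have := room8 => V8; have := T_gt0 => T0.
have gT : hroot t <= 2 * T by nia.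
have e0 : ev (tshift 0) = T by rewrite evshift // addn0.
have n2 : ev (tnum 2) = 2 by apply: evnum; lia.
have r2 : ev (tadd troot (tnum 2)) = (hroot t).+2.
  by rewrite -[RHS]addn2; apply: evadd; rewrite ?evroot //; lia.
case: c; rewrite [tcst _]/= [cval _ _]/= //.
- by apply: evpow e0 _; lia.
- by apply: evpred; rewrite ?expn_gt0 //; apply: evpow e0 _; lia.
- exact: evroot.
- by apply: evpred; rewrite ?expn_gt0 //; apply: evpow evroot _; lia.
- by apply: evpred; rewrite ?expn_gt0 //; apply: evpow r2 _; lia.
- apply: evpred; rewrite ?expn_gt0 // -[(hroot t).+1]addn1; apply: evpow; last lia.
  by apply: evadd; rewrite ?evroot //; lia.
- by apply: evgeo; rewrite ?evroot //; lia.
- by apply: evgeo; rewrite ?evroot //; nia.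
Qed.

Lemma evE : ev tE = E.
Proof.
have := room; have := K_ge2 => ? ?.
by apply: evmul evK _; [apply: evmul evK _; first exact: evshift|]; room_lia.
Qed.

Lemma evones : ev tones = enc (2 ^ E) K (fun=> 1).
Proof.
apply: evgeo evE evK _ _ room; rewrite ?muln_gt0 !expn_gt0 //.
Qed.

Lemma eve : ev te = e. Proof. exact: evshift. Qed.

Lemma eveK : ev teK = e * K.
Proof.
by apply: evmul eve evK _; room_lia.
Qed.

Lemma eveK1 : ev teK1 = e + e * K.
Proof.
by apply: evadd eve eveK _; room_lia.
Qed.

Lemma enc_lt_universe n x : (forall i, i < K -> x i < 2 ^ n) -> n * K < V ->
  enc (2 ^ n) K x < U.
Proof.
move=> xn nV; apply: leq_trans (enc_lt xn) _.
by rewrite -expnM leq_pexp2l // ltnW.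
Qed.

Lemma evrebase u l n x : ev u = enc (2 ^ E) K x -> ev l = n -> n * K < E ->
  (forall i, i < K -> x i < 2 ^ n) -> ev (trebase u l) = enc (2 ^ n) K x.
Proof.
move=> uE ln nE xn; have := room; have := K_ge2 => K2 rm.
have EV : E < V by nia.
have nV : n < V by nia.
(* The code in base [2 ^ n] is below [2 ^ (n * K)], hence below the modulus [2 ^ E - 2 ^ n]. *)
have nKE : 2 ^ (n * K) + 2 ^ n <= 2 ^ E.
  apply: (@leq_trans (2 ^ (n * K).+1)); last by rewrite leq_pexp2l.
  by rewrite expnS mul2n -addnn leq_add2l leq_pexp2l //; nia.
have nE' : 2 ^ n <= 2 ^ E by lia.
rewrite tev_mod // tev_sub // (evpow evE) // (evpow ln) // uE enc_mod //.
by have := enc_lt xn; rewrite -expnM; lia.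
Qed.

Section Vectors.

Variables (off : nat) (x : nat -> nat -> nat).
Hypothesis xE : forall j, nth 0 [:: t, d & r] (off + j) = enc (2 ^ E) K (x j).
Hypothesis x_lt : forall j i, x j i < 2 ^ S.

(** The weight keeps all digits below [2 ^ E], so there are no carries between digits and no
    reduction modulo [U]. *)
Lemma evex a : weight a <= 8 ->
  ev (tex off a) = enc (2 ^ E) K (fun i => dex t (fun j => x j i) a).
Proof.
have := room; have K2 := K_ge2 => rm.
have lt b : weight b <= 8 -> forall i, i < K -> dex t (fun j => x j i) b < 2 ^ E.
  move=> b8 i iK; apply: leq_trans (dex_lt _ _) _ => //.
  by rewrite leq_pexp2l //; room_lia.
have ltU b : weight b <= 8 -> enc (2 ^ E) K (fun i => dex t (fun j => x j i) b) < U.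
  by move=> b8; apply: enc_lt_universe => //; apply: lt.
elim: a => [j|c|e1 IH1 e2 IH2|c e1 IH|e1 IH1 e2 IH2] a8;
  rewrite [tex _ _]/=; rewrite /= in a8.
- exact: xE.
- have eE : ev (tcst c) * ev tones = enc (2 ^ E) K (fun=> cval t c).
    by rewrite evcst evones -enc_cst.
  by rewrite tev_mul eE //; apply: (ltU (XCst c)).
- have {}IH1 := IH1 ltac:(lia); have {}IH2 := IH2 ltac:(lia).
  by rewrite tev_add IH1 IH2 encD //; apply: (ltU (XAdd e1 e2)).
- have {}IH := IH ltac:(lia).
  by rewrite tev_mul IH evcst encM //; apply: (ltU (XScal c e1)).
- have {}IH1 := IH1 ltac:(lia); have {}IH2 := IH2 ltac:(lia).
  by rewrite tev_cap // IH1 IH2 enc_land //; apply: lt; lia.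
Qed.

Lemma fholds_fcn c : wf c ->
  fholds v [:: t, d & r] (fcn off c) <-> forall i, i < K -> dcn t (fun j => x j i) c.
Proof.
have := room; have K2 := K_ge2; have T0 := T_gt0 => rm.
case: c => [e1 e2 /andP[w1 w2]|j1 j2 j3 _].
  rewrite /fcn fholds_eq !evex //; split=> [|H]; last by apply: eq_enc => i iK; apply: H.
  have lt b : weight b <= 8 -> forall i, i < K -> dex t (fun j => x j i) b < 2 ^ E.
    move=> b8 i iK; apply: leq_trans (dex_lt _ _) _ => //.
    by rewrite leq_pexp2l //; room_lia.
  by apply: enc_inj; apply: lt.
have xlt n j i : S <= n -> x j i < 2 ^ n.
  by move=> Sn; apply: leq_trans (x_lt j i) _; rewrite leq_pexp2l.
(* [e] is twice [S], so a product of two digits fits in one digit of base [2 ^ e]. *)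
have prod_lt i j : x j1 i * x j2 j < 2 ^ e.
  by rewrite (_ : e = S + S) ?(expnD 2 S S) ?ltn_mul //; room_lia.
have ediag : ev tdiag = (2 ^ e - 1) * enc (2 ^ e * 2 ^ (e * K)) K (fun=> 1).
  have eo : ev (tgeo teK1 tK) = enc (2 ^ e * 2 ^ (e * K)) K (fun=> 1).
    by rewrite -expnD; apply: evgeo eveK1 evK _ _ _; rewrite ?addn_gt0 ?expn_gt0 //; room_lia.
  have ep : ev (tpred (tpow te)) = 2 ^ e - 1.
    by apply: evpred; rewrite ?expn_gt0 //; apply: evpow eve _; room_lia.
  rewrite tev_mul ep eo // -enc_cst -expnD.
  apply: enc_lt_universe; last by room_lia.
  move=> i iK; apply: (@leq_trans (2 ^ e)); last by rewrite leq_pexp2l // leq_addr.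
  by rewrite ltn_subrL expn_gt0.
have e1 : ev (trebase (TVar (off + j1)) te) = enc (2 ^ e) K (x j1).
  apply: evrebase eve _ _; [exact: xE|by room_lia|].
  by move=> i _; apply: xlt; room_lia.
have e2 : ev (trebase (TVar (off + j2)) teK) = enc (2 ^ (e * K)) K (x j2).
  apply: evrebase eveK _ _; [exact: xE|by room_lia|].
  by move=> i _; apply: xlt; room_lia.
have e3 : ev (trebase (TVar (off + j3)) teK1) = enc (2 ^ (e + e * K)) K (x j3).
  apply: evrebase eveK1 _ _; [exact: xE|by room_lia|].
  by move=> i _; apply: xlt; room_lia.
rewrite /fcn fholds_eq.
have -> : ev (tcap (tmul (trebase (TVar (off + j1)) te) (trebase (TVar (off + j2)) teK)) tdiag)
          = enc (2 ^ (e + e * K)) K (fun i => x j1 i * x j2 i).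
  rewrite tev_cap // ediag tev_mul e1 e2.
    by rewrite (expnD 2 e (e * K)); apply: enc_diag => i j _ _; apply: prod_lt.
  apply: (@leq_trans ((2 ^ e) ^ K * (2 ^ (e * K)) ^ K)).
    apply: ltn_mul; apply: enc_lt => i _; apply: xlt; room_lia.
  by rewrite -!expnM -expnD leq_pexp2l //; room_lia.
rewrite e3; split=> [|H]; last by apply: eq_enc => i iK; apply: H.
apply: enc_inj => i _; last by apply: xlt; room_lia.
by apply: leq_trans (prod_lt i i) _; rewrite leq_pexp2l // leq_addr.
Qed.

Lemma fholds_fcns cs : all wf cs ->
  fholds v [:: t, d & r] (fands [seq fcn off c | c <- cs]) <->
  forall i, i < K -> dcns t (fun j => x j i) cs.
Proof.
elim: cs => [|c cs IH] /=; first by split.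
move=> /andP[wc wcs]; rewrite (IH wcs) (fholds_fcn wc).
by split=> [[H1 H2] i iK|H]; [split; [apply: H1|apply: H2]|split=> i iK; have [] := H i iK].
Qed.

End Vectors.

Lemma fholds_finside off j u c : ev u = c -> c < 2 ^ E ->
  fholds v [:: t, d & r] (finside j off u) <->
  land (nth 0 [:: t, d & r] (off + j)) (enc (2 ^ E) K (fun=> c)) = nth 0 [:: t, d & r] (off + j).
Proof.
move=> uc cE; rewrite /finside fholds_eq tev_cap // tev_mul uc evones -enc_cst //.
by apply: enc_lt_universe room.
Qed.

End Room.

(** * One existential formula for the constraints at all positions *)

Section Main.

Variables (k m : nat) (cs : seq cn) (v d t : nat) (l : seq nat).
Hypotheses (td : t < d) (hv : t + 10 * (d - t) <= v).
Hypotheses (szl : size l = k.+1) (km : k < m).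
Hypothesis lU : all (fun x => x < 2 ^ (2 ^ d)) l.
Hypothesis wfcs : all wf cs.

Local Notation U := (2 ^ (2 ^ v)).
Local Notation K := (2 ^ (d - t)).
Local Notation B := (2 ^ (2 ^ t)).
Local Notation S := (2 ^ (t + 3)).
Local Notation E := (2 ^ (t + 6) * K * K).

Lemma all_env xs : all (fun x => x < U) xs -> all (fun x => x < U) [:: t, d & l ++ xs].
Proof.
move=> xsU; have dv : d <= v by lia.
rewrite /= all_cat xsU andbT !lt_universe //=; last lia.
by apply: sub_all lU => x xd; apply: leq_trans xd (universe_mono dv).
Qed.

Lemma nth_vector xs j : nth 0 [:: t, d & l ++ xs] (k.+3 + j) = nth 0 xs j.
Proof. by rewrite /= nth_cat szl ltnNge leq_addr /= addKn. Qed.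

Lemma digit_bits_lt_E : S < E.
Proof.
rewrite -!expnD ltn_exp2l //; lia.
Qed.

(** For codes of digits below [2 ^ S] the first conjunct of [fmain] is automatic, and the other two
    can be read position by position. *)
Lemma fholds_fmain xs (x : nat -> nat -> nat) :
  size xs = m -> all (fun x => x < U) xs ->
  (forall j, nth 0 xs j = enc (2 ^ E) K (x j)) -> (forall j i, x j i < 2 ^ S) ->
  fholds v [:: t, d & l ++ xs] (fmain k m cs) <->
  forall i, i < K -> (forall j, j < k.+1 -> x j i = dig B (nth 0 l j) i) /\
                     dcns t (fun j => x j i) cs.
Proof.
move=> sz xsU xE x_lt; have sU := all_env xsU.
have SE := digit_bits_lt_E.
have xltE j i : x j i < 2 ^ E by apply: leq_trans (x_lt j i) _; rewrite leq_pexp2l // ltnW.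
have B0 : 0 < B := universe_gt0 t.
have nthE j : nth 0 [:: t, d & l ++ xs] (k.+3 + j) = enc (2 ^ E) K (x j).
  by rewrite -xE nth_vector.
have lB j : nth 0 l j < B ^ K.
  rewrite -universe_digits; last lia.
  case: (ltnP j (size l)) => jl; first exact: (all_nthP 0 lU).
  by rewrite nth_default ?universe_gt0.
have T0 : 0 < 2 ^ t by rewrite expn_gt0.
have K0 : 0 < K by rewrite expn_gt0.
have TKE : 2 ^ t * K < E by rewrite -!expnD ltn_exp2l //; lia.
have BE : B - 1 < 2 ^ E.
  apply: (@leq_trans B); first by rewrite ltn_subrL B0.
  by rewrite leq_pexp2l //; nia.
have inS j : fholds v [:: t, d & l ++ xs] (finside j k.+3 (tpred (tpow (tshift 3)))).
  have eS := evmask td hv sU.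
  have c_lt : 2 ^ S - 1 < 2 ^ E.
    by apply: leq_ltn_trans (leq_subr _ _) _; rewrite ltn_exp2l.
  rewrite (fholds_finside td hv sU _ _ eS) // nthE enc_land //.
  by apply: eq_enc => i iK; rewrite land_mask modn_small.
have inB j : j < k.+1 ->
    (fholds v [:: t, d & l ++ xs] (FAnd (finside j k.+3 (tcst CB1))
       (FEq (trebase (TVar (k.+3 + j)) (tshift 0)) (TVar (2 + j)))) <->
     forall i, i < K -> x j i = dig B (nth 0 l j) i).
  move=> jk.
  have rebE : (forall i, i < K -> x j i < B) ->
      tev v [:: t, d & l ++ xs] (trebase (TVar (k.+3 + j)) (tshift 0)) = enc B K (x j).
    move=> xB; apply: (evrebase td hv sU) => //; last by rewrite evshift // addn0.
    exact: nthE.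
  have lE : tev v [:: t, d & l ++ xs] (TVar (2 + j)) = nth 0 l j.
    by rewrite /= nth_cat szl jk.
  have inE : fholds v [:: t, d & l ++ xs] (finside j k.+3 (tcst CB1)) <->
      forall i, i < K -> x j i < B.
    rewrite (fholds_finside td hv sU _ _ (evcst td hv sU CB1)) // nthE enc_land //.
    split=> [E i iK|H]; last first.
      by apply: eq_enc => i iK; rewrite [cval _ _]/= land_mask modn_small ?H.
    have := enc_inj _ _ E iK; rewrite [cval _ _]/= land_mask => <-.
    - by rewrite ltn_mod.
    - by move=> i' _; apply: leq_ltn_trans (land_leql _ _) (xltE _ _).
    - by move=> i' _; apply: xltE.
  rewrite fholds_and inE fholds_eq lE.
  split=> [[xB]|H].
    rewrite rebE // {1}(enc_digits (lB j)) => /enc_inj H i iK.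
    by apply: H => // i' _; apply: dig_lt.
  have xB i : i < K -> x j i < B by move=> iK; rewrite H // dig_lt.
  split=> //; rewrite rebE // [RHS](enc_digits (lB j)); exact: eq_enc.
rewrite /fmain fholds_and fholds_and !fholds_fands_iota.
rewrite (fholds_fcns td hv sU nthE) //.
split=> [[_ [H1 H2]] i iK|H].
  split=> [j jk|]; last exact: H2.
  by have [/(_ (H1 j jk)) H _] := inB j jk; apply: H.
split=> [j _|]; first exact: inS.
by split=> [j jk|i iK]; [apply/(inB j jk) => i iK|]; have [] := H i iK; [move=> H' _; apply: H'|].
Qed.

(** Forwards, the masks make the quantified numbers codes, whose digits at position [i] solve the
    system. Backwards, one solution is chosen for each of the finitely many positions, and the
    resulting matrix is read along its other direction. *)
Theorem fmain_correct :
  (exists xs, [/\ size xs = m, all (fun x => x < U) xs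
                & fholds v [:: t, d & l ++ xs] (fmain k m cs)]) <->
  forall i, i < K ->
    exists ys, [/\ size ys = m, all (fun y => y < 2 ^ S) ys,
      forall j, j < k.+1 -> nth 0 ys j = dig B (nth 0 l j) i & dcns t (nth 0 ys) cs].
Proof.
have SE := digit_bits_lt_E.
split=> [[xs [sz xsU H]] i iK|].
  have sU := all_env xsU.
  have insE j : j < m -> nth 0 xs j = enc (2 ^ E) K (dig (2 ^ E) (nth 0 xs j)) /\
      forall i, i < K -> dig (2 ^ E) (nth 0 xs j) i < 2 ^ S.
    move=> jm; move: (H); rewrite /fmain fholds_and fholds_and.
    rewrite fholds_fands_iota => -[/(_ j jm)]; have eS := evmask td hv sU.
    have c_lt : 2 ^ S - 1 < 2 ^ E.
      by apply: leq_ltn_trans (leq_subr _ _) _; rewrite ltn_exp2l.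
    rewrite (fholds_finside td hv sU _ _ eS) // => /(enc_submask c_lt).
    rewrite nth_vector => -[E1 E2] _; split=> // i' iK'.
    by rewrite -E2 // land_mask ltn_mod expn_gt0.
  (* The value 0 outside the range makes the bound [x_lt] hold for every position. *)
  pose x j i := if i < K then dig (2 ^ E) (nth 0 xs j) i else 0.
  have x_lt j i' : x j i' < 2 ^ S.
    rewrite /x; case: ifP => iK'; last by rewrite expn_gt0.
    case: (ltnP j m) => jm; first by have [_ ->] := insE j jm.
    by rewrite nth_default ?sz // /dig div0n mod0n expn_gt0.
  have xE j : nth 0 xs j = enc (2 ^ E) K (x j).
    rewrite (@eq_enc _ _ _ (dig (2 ^ E) (nth 0 xs j))); last by move=> i' iK'; rewrite /x iK'.
    case: (ltnP j m) => jm; first by have [] := insE j jm.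
    rewrite nth_default ?sz // /enc big1 // => i' _.
    by rewrite /dig div0n mod0n.
  have [H1 _] := fholds_fmain sz xsU xE x_lt.
  have [H2 H3] := H1 H i iK.
  exists (mkseq (fun j => x j i) m).
  have nthx j : nth 0 (mkseq (fun j => x j i) m) j = x j i.
    case: (ltnP j m) => jm; first by rewrite nth_mkseq.
    by rewrite nth_default ?size_mkseq // /x iK nth_default ?sz // /dig div0n mod0n.
  split; rewrite ?size_mkseq //.
  - by apply/allP => y /mapP[j _ ->].
  - by move=> j jk; rewrite nthx H2.
  - by apply: eq_dcns H3 => j; rewrite nthx.
move=> H; have {H} [F FP] := fin_all_exists (fun i : 'I_K => H i (ltn_ord i)).
pose x j i := if insub i is Some o then nth 0 (F o) j else 0.
have x_lt j i : x j i < 2 ^ S.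
  rewrite /x; case: insubP => [o _ _|_]; last by rewrite expn_gt0.
  have [szF Flt _ _] := FP o; case: (ltnP j m) => jm.
    by apply: (all_nthP 0 Flt); rewrite szF.
  by rewrite nth_default ?szF // expn_gt0.
have xF i (iK : i < K) j : x j i = nth 0 (F (Ordinal iK)) j.
  by rewrite /x insubT.
pose xs := mkseq (fun j => enc (2 ^ E) K (x j)) m.
have szxs : size xs = m by rewrite size_mkseq.
have EU : E * K <= 2 ^ v := ltnW (room td hv).
have xltE j i : x j i < 2 ^ E by apply: leq_trans (x_lt j i) _; rewrite leq_pexp2l // ltnW.
have xsU : all (fun x => x < U) xs.
  apply/allP => y /mapP[j _ ->]; apply: leq_trans (enc_lt (fun i _ => xltE j i)) _.
  by rewrite -expnM leq_pexp2l.
have xE j : nth 0 xs j = enc (2 ^ E) K (x j).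
  case: (ltnP j m) => jm; first by rewrite nth_mkseq.
  rewrite nth_default ?szxs // /enc big1 // => i _.
  have [szF _ _ _] := FP i.
  by rewrite /x valK nth_default ?szF.
exists xs; split => //; apply/(fholds_fmain szxs xsU xE x_lt) => i iK.
have [szF _ H1 H2] := FP (Ordinal iK); split=> [j jk|]; first by rewrite xF H1.
by apply: eq_dcns H2 => j; rewrite xF.
Qed.

End Main.

(** * The constraints of each symbol *)

(* Variable 0 is the digit of the value; variables 1, ..., k are the digits of
   the arguments in reverse order; the other ones are auxiliary. *)
Definition system (f : fsymb) : nat * seq cn :=
  let y := XVar in let c := XCst in let one := XCst C1 in
  match f with
  | Zero => (1, [:: CEq (y 0) (c C0)])
  | One => (1, [:: CEq (y 0) one])
  | MinusOne => (1, [:: CEq (y 0) (c CB1)])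
  | Nbits => (1, [:: CEq (y 0) (c CT)])
  | Compl => (2, [:: CEq (XAdd (y 0) (y 1)) (c CB1)])
  | Cap => (3, [:: CEq (XLand (y 2) (y 1)) (y 0)])
  | Add => (4, [:: CEq (XAdd (y 2) (y 1)) (XAdd (y 0) (XScal CB (y 3)))])
  | Mul => (5, [:: CMul 2 1 3; CEq (y 3) (XAdd (y 0) (XScal CB (y 4)))])
  | Max => (6, [:: CEq (y 0) (XAdd (y 1) (y 3)); CEq (y 0) (XAdd (y 2) (y 4));
                   CMul 3 4 5; CEq (y 5) (c C0)])
  | Min => (6, [:: CEq (y 1) (XAdd (y 0) (y 3)); CEq (y 2) (XAdd (y 0) (y 4));
                   CMul 3 4 5; CEq (y 5) (c C0)])
  (* 3, 4: truth values of y1 <> 0 and y1 = 0; 7: the remainder. *)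
  | Div => (10, [:: CEq (XAdd (y 3) (y 4)) one; CEq (y 9) (c C0);
                   CMul 4 1 9; CMul 4 0 9; CEq (y 1) (XAdd (y 3) (y 5));
                   CMul 1 0 6; CEq (y 2) (XAdd (y 6) (y 7));
                   CEq (XAdd (XAdd (y 7) (y 3)) (y 8)) (XAdd (y 1) (XScal CB (y 4)))])
  (* 2, 3: truth values of y1 >= 2^t and y1 < 2^t; 6 = y3 y1 = g y7 + y8;
     9 = 2^(g y7); 14 = 2^((g+2) y8); 19 = 2^y8; 22 = 2^y6. *)
  | Pow => (24,
     [:: CEq (XAdd (y 2) (y 3)) one; CEq (y 1) (XAdd (XScal CT (y 2)) (y 4));
         CEq (XAdd (XAdd (y 1) one) (y 5)) (XAdd (c CT) (XScal CB (y 2)));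
         CMul 3 1 6; CEq (y 6) (XAdd (XScal Cg (y 7)) (y 8));
         CEq (y 9) (XAdd (y 10) one); CEq (XLand (y 9) (y 10)) (c C0);
         CEq (XLand (y 9) (c CMg)) (y 9); CEq (y 10) (XScal CG1 (y 11));
         CEq (y 11) (XAdd (y 7) (XScal CG1 (y 12)));
         CEq (XAdd (XAdd (y 7) one) (y 13)) (c Cg);
         CEq (y 14) (XAdd (y 15) one); CEq (XLand (y 14) (y 15)) (c C0);
         CEq (XLand (y 14) (c CMh)) (y 14); CEq (y 15) (XScal CH1 (y 16));
         CEq (y 16) (XAdd (y 8) (XScal CH1 (y 17)));
         CEq (XAdd (XAdd (y 8) one) (y 18)) (c Cg);
         CEq (y 14) (XAdd (y 19) (XScal CL1 (y 20)));
         CEq (XAdd (XAdd (y 19) one) (y 21)) (c CL1);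
         CMul 9 19 22; CMul 3 22 23; CEq (y 0) (XAdd (y 23) (XScal CB1 (y 2)))])
  end.

Lemma wf_system f : all wf (system f).2.
Proof. by case: f. Qed.

Lemma arity_system f : arity f < (system f).1.
Proof. by case: f. Qed.

Definition solvable f t (c : seq nat) : Prop :=
  exists ys, [/\ size ys = (system f).1, all (fun y => y < 2 ^ (2 ^ (t + 3))) ys,
    forall j, j < size c -> nth 0 ys j = nth 0 c j & dcns t (nth 0 ys) (system f).2].

Lemma solvable_cat f t c zs : size (c ++ zs) = (system f).1 ->
  all (fun y => y < 2 ^ (2 ^ (t + 3))) (c ++ zs) -> dcns t (nth 0 (c ++ zs)) (system f).2 ->
  solvable f t c.
Proof.
by move=> sz lt H; exists (c ++ zs); split=> // j jc; rewrite nth_cat jc.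
Qed.

Lemma base_sq_le t : 2 ^ (2 ^ t) * 2 ^ (2 ^ t) * 2 <= 2 ^ (2 ^ (t + 3)).
Proof.
rewrite -expnD -expnSr leq_pexp2l // (expnD 2 t 3).
have : 0 < 2 ^ t by rewrite expn_gt0.
lia.
Qed.

(** * Congruences that characterize powers of 2 *)

Lemma eq_mod_lt a b n r s : a + n * r = b + n * s -> a < n -> b < n -> a = b.
Proof.
move=> E an bn; have := congr1 (modn^~ n) E.
by rewrite !(addnC _ (n * _)) !(mulnC n) !modnMDl !modn_small.
Qed.

(** A change to base 1, in which the code of [e] ones is [e]. *)
Lemma geometric_cong n e : exists r, enc (2 ^ n) e (fun=> 1) = e + (2 ^ n - 1) * r.
Proof.
have [|r ->] := @enc_base (2 ^ n) 1 e (fun=> 1); first by rewrite expn_gt0.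
exists r; congr (_ + _); rewrite /enc (eq_bigr (fun=> 1)) ?sum1_card ?card_ord //.
by move=> i _; rewrite exp1n.
Qed.

Lemma exp_cong X Y n : Y <= X -> exists r, X ^ n = Y ^ n + (X - Y) * r.
Proof.
move=> YX; elim: n => [|n [r rE]]; first by exists 0; rewrite muln0.
exists (Y ^ n + X * r); rewrite !expnS rE mulnDr -{1}(subnKC YX); nia.
Qed.

(* The exponent of [p = (2^n)^e] is read off from [(p - 1) / (2^n - 1)], which is
   congruent to [e] modulo [2^n - 1]. *)
Lemma log_unique n g p w e s r : 0 < n -> g <= 2 ^ n - 1 -> e < g ->
  p = w + 1 -> land p w = 0 -> land p (enc (2 ^ n) g (fun=> 1)) = p ->
  w = (2 ^ n - 1) * s -> s = e + (2 ^ n - 1) * r -> p = 2 ^ (n * e).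
Proof.
move=> n0 gn eg; rewrite addn1 => -> /pow2_of_land[j jE].
have n1 : 1 < 2 ^ n by rewrite -{1}(expn0 2) ltn_exp2l.
rewrite jE land_pow2l => bj wE sE.
(* The ones of the mask are at the multiples of [n] below [n * g], so [j] is among these. *)
have {}bj : bit (enc (2 ^ n) g (fun=> 1)) j.
  by case: bit bj => //; rewrite mul0n => /esym/eqP; rewrite expn_eq0.
have jlt : j %/ n < g.
  rewrite ltn_divLR // ltnNge; apply/negP => gj; move: bj; rewrite bit_small //.
  by apply: enc1_lt => //; rewrite mulnC.
have jn : j = n * (j %/ n).
  move: bj; rewrite {1 2}(divn_eq j n) mulnC bit_enc ?ltn_mod //.
  case: (posnP (j %% n)) => [->|j0]; first by rewrite addn0.
  by rewrite bit_small // -{1}(expn0 2) ltn_exp2l.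
set i := j %/ n in jlt jn; have [r' iE] := geometric_cong n i.
have sE' : s = enc (2 ^ n) i (fun=> 1).
  apply/eqP; rewrite -(@eqn_pmul2l (2 ^ n - 1)) ?subn_gt0 // enc1E -wE.
  by rewrite -expnM -jn -jE subn1.
(* Both [e] and [i] are congruent to [s] modulo [2 ^ n - 1], and both are less than
   [g <= 2 ^ n - 1]. *)
suff -> : e = i by rewrite -jn.
by apply: (@eq_mod_lt _ _ (2 ^ n - 1) r r'); rewrite -?sE ?sE' ?iE //; apply: leq_trans gn.
Qed.

(** Conversely to [log_unique], the power of exponent [n * e] passes all these tests, with a
    geometric sum as the quotient [s]. *)
Lemma log_exists n g e : 0 < n -> e < g ->
  exists s r, [/\ 2 ^ (n * e) - 1 = (2 ^ n - 1) * s, s = e + (2 ^ n - 1) * r,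
    land (2 ^ (n * e)) (2 ^ (n * e) - 1) = 0 &
    land (2 ^ (n * e)) (enc (2 ^ n) g (fun=> 1)) = 2 ^ (n * e)].
Proof.
move=> n0 eg; have [r rE] := geometric_cong n e.
have n1 : 1 < 2 ^ n by rewrite -{1}(expn0 2) ltn_exp2l.
exists (enc (2 ^ n) e (fun=> 1)), r; split=> //.
- by rewrite enc1E expnM.
- exact: land_pow2.
- by rewrite land_pow2l -{1}(addn0 (n * e)) bit_enc // mul1n.
Qed.

(* [2^(g+2)] is congruent to [2] modulo [2^(g+1) - 1]. *)
Lemma pow_descent g e : exists q, 2 ^ (g.+2 * e) = 2 ^ e + (2 ^ g.+1 - 1) * q.
Proof.
have [|r rE] := @exp_cong (2 ^ g.+2) 2 e; first by rewrite expnS leq_pmulr // expn_gt0.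
(* The factor 2 comes from [2 ^ g.+2 - 2 = 2 * (2 ^ g.+1 - 1)]. *)
by exists (2 * r); rewrite expnM rE (expnS 2 g.+1); congr (_ + _); nia.
Qed.

(** * Correctness of the system of each symbol *)

Section Systems.

Variable t : nat.
Local Notation T := (2 ^ t).
Local Notation B := (2 ^ (2 ^ t)).

Lemma base_gt0 : 0 < B. Proof. exact: universe_gt0. Qed.

Lemma solvable_const f b : arity f = 0 -> b < B ->
  (solvable f t [:: b] <-> match f with
   | Zero => 0 = b | One => 1 = b | MinusOne => B - 1 = b | _ => T = b end).
Proof.
move=> f0 bB; have BB := base_sq_le t; have b0 := base_gt0.
have bS : b < 2 ^ (2 ^ (t + 3)) by nia.
case: f f0 => // _; split=> [[ys [_ _ /(_ 0 isT) /= <- [-> _]] //]|H];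
  by apply: (@solvable_cat _ _ _ [::]) => //=; rewrite ?bS.
Qed.

Lemma solvable_compl b a : b < B -> a < B ->
  (solvable Compl t [:: b; a] <-> b + a = B - 1).
Proof.
move=> bB aB; have BB := base_sq_le t; have b0 := base_gt0.
split=> [[ys [_ _ yE []]] /=|H]; first by rewrite (yE 0) // (yE 1).
apply: (@solvable_cat _ _ _ [::]) => //=; apply/and3P; split=> //; nia.
Qed.

Lemma solvable_cap b a1 a0 : b < B -> a1 < B -> a0 < B ->
  (solvable Cap t [:: b; a1; a0] <-> land a0 a1 = b).
Proof.
move=> bB a1B a0B; have BB := base_sq_le t; have b0 := base_gt0.
split=> [[ys [_ _ yE []]] /=|H]; first by rewrite (yE 0) // (yE 1) // (yE 2).
apply: (@solvable_cat _ _ _ [::]) => //=; apply/and4P; split=> //; nia.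
Qed.

Lemma solvable_add b a1 a0 : b < B -> a1 < B -> a0 < B ->
  (solvable Add t [:: b; a1; a0] <-> (a0 + a1) %% B = b).
Proof.
move=> bB a1B a0B; have BB := base_sq_le t; have b0 := base_gt0.
split=> [[ys [_ _ yE []]] /=|<-].
  by rewrite (yE 0) // (yE 1) // (yE 2) //= => -> _; rewrite addnC mulnC modnMDl modn_small.
apply: (@solvable_cat _ _ _ [:: (a0 + a1) %/ B]) => //=; last first.
  by split=> //; rewrite [RHS]addnC [B * _]mulnC -divn_eq.
have ? : (a0 + a1) %% B < B by rewrite ltn_mod.
have ? : (a0 + a1) %/ B <= a0 + a1 by apply: leq_div.
by rewrite !andbT; apply/and4P; split=> //; nia.
Qed.

Lemma solvable_mul b a1 a0 : b < B -> a1 < B -> a0 < B ->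
  (solvable Mul t [:: b; a1; a0] <-> (a0 * a1) %% B = b).
Proof.
move=> bB a1B a0B; have BB := base_sq_le t; have b0 := base_gt0.
split=> [[ys [_ _ yE []]] /=|<-].
  by rewrite (yE 0) // (yE 1) // (yE 2) //= => -> [-> _]; rewrite addnC mulnC modnMDl modn_small.
apply: (@solvable_cat _ _ _ [:: a0 * a1; (a0 * a1) %/ B]) => //=; last first.
  by split=> //; split=> //; rewrite [RHS]addnC [B * _]mulnC -divn_eq.
have ? : (a0 * a1) %% B < B by rewrite ltn_mod.
have ? : (a0 * a1) %/ B <= a0 * a1 by apply: leq_div.
have ? : a0 * a1 < B * B by apply: ltn_mul.
by rewrite !andbT; apply/and5P; split=> //; nia.
Qed.

Lemma solvable_max b a1 a0 : b < B -> a1 < B -> a0 < B ->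
  (solvable Max t [:: b; a1; a0] <-> maxn a0 a1 = b).
Proof.
move=> bB a1B a0B; have BB := base_sq_le t; have b0 := base_gt0.
split=> [[ys [_ _ yE []]] /=|H].
  rewrite (yE 0) // (yE 1) // (yE 2) //= => h1 [h2 [h3 [h4 _]]].
  (* The differences of [b] with the two arguments have product 0, so [b] equals one of them while
     bounding both. *)
  by move: h3; rewrite h4 => /eqP; rewrite muln_eq0; lia.
apply: (@solvable_cat _ _ _ [:: b - a1; b - a0; 0]) => //=.
  by rewrite !andbT; do 4!(apply/andP; split; first by nia); nia.
by do !split; lia.
Qed.

Lemma solvable_min b a1 a0 : b < B -> a1 < B -> a0 < B ->
  (solvable Min t [:: b; a1; a0] <-> minn a0 a1 = b).
Proof.
move=> bB a1B a0B; have BB := base_sq_le t; have b0 := base_gt0.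
split=> [[ys [_ _ yE []]] /=|H].
  rewrite (yE 0) // (yE 1) // (yE 2) //= => h1 [h2 [h3 [h4 _]]].
  by move: h3; rewrite h4 => /eqP; rewrite muln_eq0; lia.
apply: (@solvable_cat _ _ _ [:: a1 - b; a0 - b; 0]) => //=.
  by rewrite !andbT; do 4!(apply/andP; split; first by nia); nia.
by do !split; lia.
Qed.

Lemma solvable_div b a1 a0 : b < B -> a1 < B -> a0 < B ->
  (solvable Div t [:: b; a1; a0] <-> a0 %/ a1 = b).
Proof.
move=> bB a1B a0B; have BB := base_sq_le t; have b0 := base_gt0.
split=> [[ys [_ _ yE]] /=|H].
  rewrite (yE 0) // (yE 1) // (yE 2) //=.
  move: (nth 0 ys 3) (nth 0 ys 4) (nth 0 ys 5) (nth 0 ys 6) (nth 0 ys 7) (nth 0 ys 8)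
    (nth 0 ys 9) => y3 y4 y5 y6 y7 y8 y9 [h1 [-> [h2 [h3 [h4 [<- [-> [h5 _]]]]]]]].
  (* If [y4 = 0] then [y3 = 1], and [h5] puts the remainder [y7] below [a1]. Otherwise [h2] and [h3]
     force [a1 = b = 0]. *)
  case: y4 h1 h2 h3 h5 => [|y4] h1 h2 h3 h5.
    by rewrite mulnC divnMDl ?divn_small ?addn0 //; lia.
  by have [-> ->] : a1 = 0 /\ b = 0 by nia.
have [a10|a10] := posnP a1.
  (* Here the remainder is [a0], and the summand [B * y4] of the last equation leaves room for
     it. *)
  apply: (@solvable_cat _ _ _ [:: 0; 1; 0; 0; a0; B - a0; 0]) => //=.
    by rewrite !andbT; do 9!(apply/andP; split; first by nia); nia.
  by rewrite a10 divn0 in H; rewrite a10 -H; do !split; lia.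
have := divn_eq a0 a1; have := ltn_pmod a0 a10; rewrite H => rlt aE.
apply: (@solvable_cat _ _ _ [:: 1; 0; a1 - 1; a1 * b; a0 %% a1; a1 - 1 - a0 %% a1; 0]) => //=.
  by rewrite !andbT; do 9!(apply/andP; split; first by nia); nia.
by do !split; lia.
Qed.

Lemma solvable_pow_sound b a : b < B -> a < B ->
  solvable Pow t [:: b; a] -> minn (2 ^ a) (B - 1) = b.
Proof.
move=> bB aB [ys [_ _ yE]] /=; rewrite (yE 0) // (yE 1) //=.
set g := hroot t; have g0 : 0 < g := hroot_gt0 t.
move: (nth 0 ys 2) (nth 0 ys 3) (nth 0 ys 4) (nth 0 ys 5) (nth 0 ys 6) (nth 0 ys 7)
  (nth 0 ys 8) (nth 0 ys 9) (nth 0 ys 10) (nth 0 ys 11) (nth 0 ys 12) (nth 0 ys 13)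
  (nth 0 ys 14) (nth 0 ys 15) (nth 0 ys 16) (nth 0 ys 17) (nth 0 ys 18) (nth 0 ys 19)
  (nth 0 ys 20) (nth 0 ys 21) (nth 0 ys 22) (nth 0 ys 23) =>
  y2 y3 y4 y5 y6 y7 y8 y9 y10 y11 y12 y13 y14 y15 y16 y17 y18 y19 y20 y21 y22 y23.
move=> [h1 [h2 [h3 [h4 [h5 [p1 [p2 [p3 [p4 [p5 [p6 [q1 [q2 [q3 [q4 [q5 [q6 [q7 [q8
  [m1 [m2 [bE _]]]]]]]]]]]]]]]]]]]]]].
have gG : g <= 2 ^ g - 1 by have := ltn_expl g (isT : 1 < 2); lia.
have gH : g <= 2 ^ g.+2 - 1.
  have : 2 ^ g <= 2 ^ g.+2 by rewrite leq_pexp2l // -addn2 leq_addr.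
  lia.
(* The slack equations [p6] and [q6] make [y7] and [y8] less than [g]. *)
have y9E : y9 = 2 ^ (g * y7) by apply: (log_unique g0 gG _ p1 p2 p3 p4 p5); lia.
have y14E : y14 = 2 ^ (g.+2 * y8) by apply: (log_unique _ gH _ q1 q2 q3 q4 q5); lia.
have [q qE] := pow_descent g y8.
have y19E : y19 = 2 ^ y8.
  (* [y19] is below the modulus by [q8], and [2 ^ y8] is so because [y8 < g]. *)
  apply: (@eq_mod_lt _ _ (2 ^ g.+1 - 1) y20 q); [by rewrite -q7 -qE|lia|].
  have : 2 ^ y8.+1 <= 2 ^ g by rewrite leq_pexp2l //; lia.
  have : 0 < 2 ^ y8 by rewrite expn_gt0.
  by rewrite !expnS; lia.
have y22E : y22 = 2 ^ y6 by rewrite -m1 y9E y19E -expnD h5.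
have T0 : 0 < 2 ^ t by rewrite expn_gt0.
(* If [y2 = 0] then [h3] gives [a < 2 ^ t]; if [y2 = 1] then [h2] gives [2 ^ t <= a] and the minimum
   is [B - 1]. *)
case: y2 h1 h2 h3 bE => [|y2] h1 h2 h3 bE.
  have ltE : y3 = 1 by lia.
  have aT : a < 2 ^ t by lia.
  rewrite bE muln0 addn0 -m2 y22E -h4 ltE !mul1n; apply/minn_idPl.
  have : 2 ^ a < B by rewrite ltn_exp2l.
  lia.
have [geE ltE] : y2 = 0 /\ y3 = 0 by lia.
rewrite bE -m2 ltE geE mul0n add0n muln1; apply/minn_idPr.
apply: leq_trans (leq_subr _ _) _; rewrite leq_pexp2l //; clear -h2; nia.
Qed.

Lemma solvable_pow_complete a : a < B -> solvable Pow t [:: minn (2 ^ a) (B - 1); a].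
Proof.
move=> aB; have BB := base_sq_le t; have b0 := base_gt0.
set g := hroot t; have g0 : 0 < g := hroot_gt0 t.
have /andP[lo hi] := hroot_bounds t; rewrite -/g in lo hi.
have T0 : 0 < 2 ^ t by rewrite expn_gt0.
set N := 2 ^ (2 ^ (t + 3)) in BB *.
have TB : 2 ^ t < B by apply: ltn_expl.
pose lt := (a < 2 ^ t : nat); pose ge := (2 ^ t <= a : nat).
(* For [a >= 2 ^ t] the exponent is replaced by 0, which keeps all auxiliary powers within the bound
   on digits. *)
pose x := lt * a.
have xT : x < 2 ^ t by rewrite /x /lt; case: ltnP; lia.
pose e1 := x %/ g; pose e0 := x %% g.
have xE : x = g * e1 + e0 by rewrite mulnC -divn_eq.
have e0g : e0 < g by rewrite ltn_mod.
(* Because [x < 2 ^ t <= g * g]. *)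
have e1g : e1 < g by rewrite /e1 ltn_divLR //; lia.
have gT : g <= 2 * 2 ^ t by clear -hi g0; nia.
have ge1T : g * e1 < 2 * 2 ^ t by clear -hi e1g g0; nia.
have he0T : g.+2 * e0 < 6 * 2 ^ t by clear -hi e0g gT g0; nia.
have [s1 [r1 [p1 p2 p3 p4]]] := log_exists g0 e1g.
have [s0 [r0 [q1 q2 q3 q4]]] := @log_exists g.+2 g e0 isT e0g.
have [q qE] := pow_descent g e0.
have gG : 1 <= 2 ^ g - 1 by have := ltn_expl g (isT : 1 < 2); clear -g0; lia.
have L0 : 2 ^ e0 < 2 ^ g.+1 - 1.
  have : 2 ^ e0.+1 <= 2 ^ g by rewrite leq_pexp2l.
  have : 0 < 2 ^ e0 by rewrite expn_gt0.
  by rewrite !expnS; clear; lia.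
have H0 : 1 <= 2 ^ g.+2 - 1 by have := leq_pexp2l (isT : 0 < 2) (leqnSn g.+1); clear -L0; lia.
have big n : n <= 8 * 2 ^ t -> 2 ^ n <= N.
  by move=> nT; rewrite leq_pexp2l // expnD mulnC.
have P1 : 2 ^ (g * e1) < N.
  apply: (@leq_trans (2 ^ (g * e1).+1)); first by rewrite ltn_exp2l.
  by apply: big; clear -gT ge1T he0T T0; lia.
have P0 : 2 ^ (g.+2 * e0) < N.
  apply: (@leq_trans (2 ^ (g.+2 * e0).+1)); first by rewrite ltn_exp2l.
  by apply: big; clear -gT ge1T he0T T0; lia.
have xB : 2 ^ x < B by rewrite ltn_exp2l.
have gN : g < N.
  by apply: leq_trans (ltn_expl g (isT : 1 < 2)) _; apply: big; clear -gT ge1T he0T T0; lia.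
have LN : 2 ^ g.+1 <= N by apply: big; clear -gT ge1T he0T T0; lia.
have minE : minn (2 ^ a) (B - 1) = lt * 2 ^ x + (B - 1) * ge.
  rewrite /x /lt /ge; case: ltnP => aT; rewrite ?mul1n ?muln0 ?muln1 ?addn0.
    apply/minn_idPl; have : 2 ^ a < B by rewrite ltn_exp2l.
    clear; lia.
  by apply/minn_idPr; apply: leq_trans (leq_subr _ _) _; rewrite leq_pexp2l.
have lt1 : lt <= 1 := leq_b1 _.
have ge1 : ge <= 1 := leq_b1 _.
have lg : ge + lt = 1 by rewrite /lt /ge; case: leqP.
have minB : minn (2 ^ a) (B - 1) < B by rewrite gtn_min; apply/orP; right; clear -b0; lia.
pose y4 := a - 2 ^ t * ge; pose y5 := 2 ^ t + B * ge - (a + 1).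
have y4E : a = 2 ^ t * ge + y4 by rewrite /y4 /ge; case: leqP; clear -aB; lia.
have y5E : a + 1 + y5 = 2 ^ t + B * ge by rewrite /y5 /ge; case: leqP; clear -aB; lia.
apply: (@solvable_cat _ _ _ [:: ge; lt; y4; y5; x; e1; e0;
  2 ^ (g * e1); 2 ^ (g * e1) - 1; s1; r1; g - 1 - e1;
  2 ^ (g.+2 * e0); 2 ^ (g.+2 * e0) - 1; s0; r0; g - 1 - e0;
  2 ^ e0; q; 2 ^ g.+1 - 1 - (2 ^ e0 + 1); 2 ^ x; lt * 2 ^ x]) => //.
  have BN : B * 2 <= N by clear -BB b0; nia.
  have s1N : s1 < N by clear -p1 P1 gG; nia.
  have r1N : r1 < N by clear -p2 s1N gG; nia.
  have s0N : s0 < N by clear -q1 P0 H0; nia.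
  have r0N : r0 < N by clear -q2 s0N H0; nia.
  have qN : q < N by clear -qE P0 L0; nia.
  have ltxN : lt * 2 ^ x < N by clear -lt1 xB BN; nia.
  have y5N : y5 < N by clear -y5E TB BN ge1; nia.
  have y4N : y4 < N by clear -y4E aB BN; lia.
  clear -BN s1N r1N s0N r0N qN ltxN y5N y4N minB aB TB lt1 ge1 xT e0g e1g gN P1 P0 L0 LN xB.
  rewrite -/N; clearbody N x e1 e0 y4 y5 lt ge g; rewrite [all _ _]/= !andbT.
  do 23!(apply/andP; split; first by lia); lia.
rewrite [system _]/= [dcns _ _ _]/= -/g.
repeat match goal with |- _ /\ _ => split end.
- exact: lg.
- exact: y4E.
- exact: y5E.
- by [].
- exact: xE.
- by rewrite subnK // expn_gt0.
- exact: p3.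
- exact: p4.
- exact: p1.
- exact: p2.
- by clear -e1g; lia.
- by rewrite subnK // expn_gt0.
- exact: q3.
- exact: q4.
- exact: q1.
- exact: q2.
- by clear -e0g; lia.
- exact: qE.
- by rewrite subnKC // addn1.
- by rewrite -expnD -xE.
- by [].
- exact: minE.
- by [].
Qed.

End Systems.

(** * The existential formula of a symbol *)

Definition arglist k (a : 'I_k -> nat) : seq nat := [seq a i | i <- enum 'I_k].

Lemma size_arglist k (a : 'I_k -> nat) : size (arglist a) = k.
Proof. by rewrite size_map size_enum_ord. Qed.

Lemma nth_arglist k (a : 'I_k -> nat) (i : 'I_k) : nth 0 (arglist a) i = a i.
Proof. by rewrite (nth_map i) ?size_enum_ord // nth_ord_enum. Qed.

Lemma arglist0 (a : 'I_0 -> nat) : arglist a = [::].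
Proof. by apply: size0nil; rewrite size_arglist. Qed.

Lemma arglist1 (a : 'I_1 -> nat) : arglist a = [:: a ord0].
Proof.
have := nth_arglist a ord0; have := size_arglist a.
by case: (arglist a) => // x [] //= _ ->.
Qed.

Lemma arglist2 (a : 'I_2 -> nat) : arglist a = [:: a ord0; a ord_max].
Proof.
have := nth_arglist a ord_max; have := nth_arglist a ord0; have := size_arglist a.
by case: (arglist a) => // x [] // y [] //= _ -> ->.
Qed.

Lemma solvable_opM t (f : fsymb) (a : 'I_(arity f) -> nat) b :
  (forall i, a i < 2 ^ (2 ^ t)) -> b < 2 ^ (2 ^ t) ->
  solvable f t (b :: rev (arglist a)) <-> opM t a = b.
Proof.
case: f a => a /= aB bB; rewrite ?(arglist0, arglist1, arglist2).
- by rewrite solvable_const.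
- by rewrite solvable_const.
- by rewrite solvable_const.
- by rewrite solvable_const.
- rewrite solvable_compl //; have := opM_compl (aB ord0).
  by move: (bigop _ _ _) => c; lia.
- split; first exact: solvable_pow_sound.
  by move=> <-; apply: solvable_pow_complete.
- by rewrite solvable_add.
- by rewrite solvable_mul.
- by rewrite solvable_div.
- by rewrite solvable_max.
- by rewrite solvable_min.
- by rewrite solvable_cap // opM_cap.
Qed.

(* [2^(2^t) - 1], written so that no intermediate value overflows when [v = t]. *)
Definition tbase1 :=
  let p := tpow (tpred (tpow (TVar 0))) in tadd p (tpred p).

(** For [d = t] an element is its own single digit, so a term has to compute in [M v] the operation
    of [M t]; a mask reduces sums and products. As the arguments are listed in reverse, [TVar 4] is
    the first of two and [TVar 3] the second. *)
Definition tdirect (f : fsymb) : tm :=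
  match f with
  | Zero => tzero
  | One => tone
  | MinusOne => tbase1
  | Nbits => tpow (TVar 0)
  | Compl => tsub tbase1 (TVar 3)
  | Pow => TApp Min (tpow (TVar 3)) tbase1
  | Add | Mul => tcap (TApp f (TVar 4) (TVar 3)) tbase1
  | Div | Max | Min | Cap => TApp f (TVar 4) (TVar 3)
  end.

Lemma tev_direct v t (f : fsymb) (a : 'I_(arity f) -> nat) b xs : t <= v ->
  (forall i, a i < 2 ^ (2 ^ t)) ->
  let s := [:: t, t & (b :: rev (arglist a)) ++ xs] in
  all (fun x => x < 2 ^ (2 ^ v)) s -> tev v s (tdirect f) = opM t a.
Proof.
move=> tv aB s sU; set B := 2 ^ (2 ^ t) in aB.
have tV : t < 2 ^ v by apply: leq_ltn_trans tv (ltn_expl _ _).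
have TV : 2 ^ t <= 2 ^ v by rewrite leq_pexp2l.
have T0 : 0 < 2 ^ t by rewrite expn_gt0.
have BU : B <= 2 ^ (2 ^ v) := universe_mono tv.
(* By this divisibility, the reduction in [M v] does not affect residues modulo [B]. *)
have BdU : B %| 2 ^ (2 ^ v) by rewrite dvdn_exp2l.
have eT : tev v s (tpow (TVar 0)) = 2 ^ t by rewrite (tev_pow sU).
have eT1 : tev v s (tpred (tpow (TVar 0))) = 2 ^ t - 1 by rewrite (tev_pred sU) eT.
have ep : tev v s (tpow (tpred (tpow (TVar 0)))) = 2 ^ (2 ^ t - 1).
  by rewrite (tev_pow sU) eT1 //; lia.
have p0 : 0 < 2 ^ (2 ^ t - 1) by rewrite expn_gt0.
have pE : B = 2 * 2 ^ (2 ^ t - 1) by rewrite -expnS /B; congr expn; lia.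
have eB : tev v s tbase1 = B - 1.
  rewrite /tbase1 tev_add; rewrite (tev_pred sU) ep //; lia.
have capE u : tev v s (tcap u tbase1) = tev v s u %% B.
  by rewrite (tev_cap sU) eB land_mask.
clear ep eT1 p0 pE.
case: f a aB @s sU eT eB capE => a aB s sU eT eB capE; rewrite [tdirect _]/=.
- by [].
- by [].
- by rewrite eB.
- by rewrite eT.
- have e3 : tev v s (TVar 3) = a ord0 by rewrite /s arglist1.
  have a3 := aB ord0; rewrite (tev_sub sU) eB e3; last lia.
  by have := opM_compl a3; rewrite /= -/B; move: (bigop _ _ _) => c; lia.
- have e3 : tev v s (TVar 3) = a ord0 by rewrite /s arglist1.
  transitivity (minn (tev v s (tpow (TVar 3))) (tev v s tbase1)); first by [].
  rewrite eB.
  transitivity (minn (minn (2 ^ tev v s (TVar 3)) (2 ^ (2 ^ v) - 1)) (B - 1)); first by [].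
  (* The truncation of [M v] is absorbed by the truncation at [B - 1]. *)
  by rewrite e3 -minnA; congr minn; apply/minn_idPr; lia.
- by rewrite capE /s arglist2 /= /args2 /= modn_dvdm.
- by rewrite capE /s arglist2 /= /args2 /= modn_dvdm.
- by rewrite /s arglist2.
- by rewrite /s arglist2.
- by rewrite /s arglist2.
- have e3 : tev v s (TVar 3) = a ord_max by rewrite /s arglist2.
  have e4 : tev v s (TVar 4) = a ord0 by rewrite /s arglist2.
  by rewrite [LHS](tev_cap sU) e3 e4 /= opM_cap.
Qed.

Lemma digitwiseP d t (f : fsymb) (a : 'I_(arity f) -> M d) (b : M d) :
  digitwise t a b <-> forall i, i < 2 ^ (d - t) ->
    opM t (fun j => dig (2 ^ (2 ^ t)) (val (a j)) i) = dig (2 ^ (2 ^ t)) (val b) i.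
Proof.
split=> [/forallP H i iK|H].
  by have /eqP/(congr1 val) := H (Ordinal iK).
by apply/forallP => i; apply/eqP/val_inj; apply: H.
Qed.

(** The cases [d = t] and [d > t] are distinguished inside the formula; the negated equation is
    quantifier-free, so the whole stays existential. *)
Definition fpsi (f : fsymb) : fm :=
  FOr (FAnd (FEq (TVar 1) (TVar 0)) (FEq (TVar 2) (tdirect f)))
      (FAnd (FNot (FEq (TVar 1) (TVar 0))) (fmain (arity f) (system f).1 (system f).2)).

Lemma fpsi_correct v d t (f : fsymb) (a : 'I_(arity f) -> M d) (b : M d) :
  t <= d -> t + 10 * (d - t) <= v ->
  digitwise t a b <->
  exists xs, [/\ size xs = (system f).1, all (fun x => x < 2 ^ (2 ^ v)) xs &
    fholds v ([:: t, d & val b :: rev (arglist (fun i => val (a i)))] ++ xs) (fpsi f)].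
Proof.
move=> td hv; have dv : d <= v by lia.
set av := fun i => val (a i); set l := val b :: _.
have avd i : av i < 2 ^ (2 ^ d) := ltn_ord (a i).
have bd : val b < 2 ^ (2 ^ d) := ltn_ord b.
have lU : all (fun x => x < 2 ^ (2 ^ d)) l.
  by rewrite /= bd all_rev; apply/allP => x /mapP[i _ ->].
rewrite digitwiseP; move: td; rewrite leq_eqVlt => /orP[/eqP E|td].
  subst d; rewrite subnn.
  have sU xs : all (fun x => x < 2 ^ (2 ^ v)) xs ->
      all (fun x => x < 2 ^ (2 ^ v)) [:: t, t & l ++ xs].
    move=> xsU; rewrite /= -[_ && all _ _]/(all _ (l ++ xs)) all_cat xsU andbT lt_universe //=.
    by apply: sub_all lU => x xd; apply: leq_trans xd (universe_mono dv).
  have dig0 x : x < 2 ^ (2 ^ t) -> dig (2 ^ (2 ^ t)) x 0 = x.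
    by move=> xt; rewrite /dig expn0 divn1 modn_small.
  transitivity (opM t av = val b).
    split=> [/(_ 0 isT)|H [|//] _].
      by rewrite dig0 // => <-; apply: opM_ext => j; rewrite dig0 // avd.
    by rewrite dig0 // -H; apply: opM_ext => j; rewrite dig0 // avd.
  split=> [H|[xs [_ xsU]]].
    (* Any values of the quantified variables satisfy the first disjunct; zeros are taken. *)
    exists (nseq (system f).1 0); split; rewrite ?size_nseq //.
      by apply/allP => x /nseqP[-> _]; rewrite expn_gt0.
    left; split=> //; rewrite fholds_eq tev_direct //.
    by apply: sU; apply/allP => x /nseqP[-> _]; rewrite expn_gt0.
  case=> [[_ H]|[ne _]]; last by case: ne.
  by rewrite -(tev_direct dv avd (sU xs xsU)) -H.
transitivity (exists xs, [/\ size xs = (system f).1, all (fun x => x < 2 ^ (2 ^ v)) xs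
    & fholds v [:: t, d & l ++ xs] (fmain (arity f) (system f).1 (system f).2)]); last first.
  split=> -[xs [sz xsU H]]; exists xs; split=> //.
    right; split; last exact: H.
    by move=> dt; move: td; rewrite (dt : d = t) ltnn.
  case: H => [[dt _]|[_ H]]; last exact: H.
  by move: td; rewrite (dt : d = t) ltnn.
have szl : size l = (arity f).+1 by rewrite /= size_rev size_arglist.
rewrite (fmain_correct td hv szl (arity_system f) lU (wf_system f)).
have B0 := universe_gt0 t.
have mapl i : [seq dig (2 ^ (2 ^ t)) x i | x <- l] =
    dig (2 ^ (2 ^ t)) (val b) i :: rev (arglist (fun j => dig (2 ^ (2 ^ t)) (av j) i)).
  by rewrite /= map_rev -map_comp.
split=> H i iK.
  have /(solvable_opM (f := f)) := H i iK.
  case=> [j||ys [sz lt E cs]]; rewrite ?dig_lt //.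
  exists ys; split=> // j jk; rewrite E -mapl ?size_map ?szl //.
  by rewrite (nth_map 0) ?szl.
apply/(solvable_opM (f := f)) => [j||]; rewrite ?dig_lt //.
have [ys [sz lt E cs]] := H i iK; exists ys; split=> // j.
by rewrite -mapl size_map => jl; rewrite (nth_map 0) // E // -szl.
Qed.

(** The last parameter has the largest index and so is outermost: in the order of levels one reads
    [t], [d], [b] and the arguments reversed. *)
Lemma agree_params v k (a : 'I_k -> M v) (b d t : M v) :
  agree (params a b d t)
    [:: val t, val d & val b :: rev (arglist (fun i => val (a i)))].
Proof.
set al := arglist _; have sz : size al = k := size_arglist _.
split=> [|i]; first by rewrite /= size_rev sz addn3.
have -> : rev [:: val t, val d & val b :: rev al] = al ++ [:: val b; val d; val t].
  by rewrite !rev_cons revK -!cats1 -!catA.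
rewrite nth_cat sz /params; case: splitP => [j|j] ->.
  by rewrite nth_arglist.
by rewrite addKn; case: j => -[|[|[|//]]] jlt.
Qed.

Theorem theorem7 (f : fsymb) :
  exists (c : nat) (c_gt0 : 0 < c) (psi : formula (arity f + 3)),
    existential psi /\
    forall (d t : nat) (td : t <= d) (a : 'I_(arity f) -> M d) (b : M d)
           (v : nat) (hv : t + c * (d - t) <= v),
      let dv : d <= v := bound_le c_gt0 td hv in
      fdt td a = b <->
      @sat (M v) _ psi
        (params (fun i => inclM dv (a i)) (inclM dv b)
           (natM dv) (natM (leq_trans td dv))).
Proof.
exists 10, isT, (exs (formula_of ((system f).1 + (arity f + 3)) (fpsi f))); split.
  by apply/existential_exs/quantifier_free_existential/quantifier_free_formula_of.
move=> d t td a b v hv dv; rewrite fdtP (fpsi_correct _ _ td hv).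
rewrite (sat_exs (P := fun s => fholds v s (fpsi f)) _ (agree_params _ _ _ _)) //.
by move=> e s; apply: sat_formula_of.
Qed.
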